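(* Let $0<b<\infty$, $\mu\in(0,1)$, $\nu\in[0,1]$, $\gamma,\omega\in\mathbb{R}$, $\rho>0$, and let $f\in AC^1[0,b]$. Then, for $0<t<b$, the regularized version of the Hilfer-Prabhakar fractional derivative and the Hilfer-Prabhakar fractional derivative of $f$ are related by $${}^{C}\mathbf{D}_{\rho,\omega,0^+}^{\gamma,\mu}f(t)=\mathbf{D}_{\rho,\omega,0^+}^{\gamma,\mu,\nu}f(t)-t^{-\mu}E_{\rho,1-\mu}^{-\gamma}(\omega t^{\rho})f(0^+).$$
   Context: Three-parameter Mittag-Leffler (Prabhakar) function: $E_{\alpha,\beta}^{\gamma}(z)=\sum_{k=0}^\infty \frac{(\gamma)_k}{\Gamma(\alpha k+\beta)}\frac{z^k}{k!}$, where $(\gamma)_k=\Gamma(\gamma+k)/\Gamma(\gamma)=\gamma(\gamma+1)\cdots(\gamma+k-1)$, $\mathrm{Re}(\alpha)>0$. Prabhakar integral: for $\mathrm{Re}(\rho),\mathrm{Re}(\mu)>0$, $\mathbf{E}_{\rho,\mu,\omega,0^+}^{\gamma}f(t)=\int_0^t (t-y)^{\mu-1}E_{\rho,\mu}^{\gamma}[\omega(t-y)^\rho]f(y)\,dy$, with the convention $\mathbf{E}_{\rho,0,\omega,0^+}^{0}f=f$. $AC^1[0,b]$ is the space of real-valued absolutely continuous functions on $[0,b]$; derivatives of such functions, and hence identities between the fractional derivatives below, are understood almost everywhere. Hilfer-Prabhakar fractional derivative of order $\mu$: $$\mathbf{D}_{\rho,\omega,0^+}^{\gamma,\mu,\nu}f(t)=\Big(\mathbf{E}_{\rho,\nu(1-\mu),\omega,0^+}^{-\gamma\nu}\frac{d}{dt}\big(\mathbf{E}_{\rho,(1-\nu)(1-\mu),\omega,0^+}^{-\gamma(1-\nu)}f\big)\Big)(t).$$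 Regularized version of the Hilfer-Prabhakar fractional derivative of order $\mu$: $${}^{C}\mathbf{D}_{\rho,\omega,0^+}^{\gamma,\mu}f(t)=\Big(\mathbf{E}_{\rho,\nu(1-\mu),\omega,0^+}^{-\gamma\nu}\mathbf{E}_{\rho,(1-\nu)(1-\mu),\omega,0^+}^{-\gamma(1-\nu)}\frac{d}{dt}f\Big)(t)=\Big(\mathbf{E}_{\rho,1-\mu,\omega,0^+}^{-\gamma}\frac{d}{dt}f\Big)(t).$$
   Formalization: For ν = 1 the identity is claimed only when f(0+) = 0: there both derivatives coincide by the convention E^0_{ρ,0}f = f, so the identity fails whenever f(0+) ≠ 0 (e.g. f = 1, γ = ω = 0, ρ = 1, μ = 1/2). *)

(* Defs.v *)
From HB Require Import structures.
From mathcomp Require Import all_boot all_order all_algebra.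
From mathcomp Require Import all_classical all_reals all_analysis.

Set Implicit Arguments.
Unset Strict Implicit.
Unset Printing Implicit Defensive.

Import Order.TTheory GRing.Theory Num.Theory.
Import numFieldNormedType.Exports.

Local Open Scope classical_set_scope.
Local Open Scope ring_scope.

(* Euler's integral; it is the Gamma function only for 0 < a, the only range
   where it is used below. *)
Definition Gamma {R : realType} (a : R) : R :=
  \int[lebesgue_measure]_(x in `]0, +oo[) (x `^ (a - 1) * expR (- x)).

(* The product form of Gamma (c + k) / Gamma c, defined for every real c. *)
Definition pochhammer {R : realType} (c : R) (k : nat) : R :=
  \prod_(i < k) (c + i%:R).

Definition prabhakar {R : realType} (alpha beta gamma z : R) : R :=
  limn (series (fun k : nat =>
    pochhammer gamma k / Gamma (alpha * k%:R + beta) * (z ^+ k / k`!%:R))).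

(* The first branch is the convention that the operator with both parameters
   equal to 0 is the identity. The integral is a Lebesgue integral. *)
Definition prabhakar_int {R : realType} (rho mu omega gamma : R)
    (f : R -> R) (t : R) : R :=
  if (mu == 0) && (gamma == 0) then f t
  else \int[lebesgue_measure]_(y in `[0, t])
    ((t - y) `^ (mu - 1)
     * prabhakar rho mu gamma (omega * (t - y) `^ rho) * f y).

Definition hilfer_prabhakar {R : realType} (rho omega gamma mu nu : R)
    (f : R -> R) : R -> R :=
  prabhakar_int rho (nu * (1 - mu)) omega (- gamma * nu)
    (derive1
       (prabhakar_int rho ((1 - nu) * (1 - mu)) omega (- gamma * (1 - nu)) f)).

Definition reg_hilfer_prabhakar {R : realType} (rho omega gamma mu : R)
    (f : R -> R) : R -> R :=
  prabhakar_int rho (1 - mu) omega (- gamma) (derive1 f).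

(* Absolute continuity on [a, b]; the values of f outside [a, b] are
   irrelevant. *)
Definition absolutely_continuous {R : realType} (a b : R) (f : R -> R) : Prop :=
  forall e : R, 0 < e -> exists2 d : R, 0 < d &
    forall (n : nat) (u v : 'I_n -> R),
      (forall i, [/\ a <= u i, u i <= v i & v i <= b]) ->
      trivIset [set: 'I_n] (fun i => `]u i, v i[%classic) ->
      \sum_(i < n) (v i - u i) < d ->
      \sum_(i < n) `|f (v i) - f (u i)| < e.

(* Main.v *)
From HB Require Import structures.
Require Import Defs.
From mathcomp Require Import all_boot all_order all_algebra.
From mathcomp Require Import all_classical all_reals all_analysis.
From mathcomp Require Import measurable_realfun ring lra.

Import Order.TTheory GRing.Theory Num.Theory.
Import numFieldNormedType.Exports.
Local Open Scope classical_set_scope.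
Local Open Scope ring_scope.

Set Implicit Arguments.
Unset Strict Implicit.
Unset Printing Implicit Defensive.

(* Write k_{beta,gam}(x) = x^(beta-1) E^gam_{rho,beta}(omega x^rho) for x > 0, so
   that the Prabhakar integral is the convolution with k.  The absolutely
   continuous f is f(0) + 1 * h with h integrable and f' = h almost everywhere.
   For the inner operator this gives
     k * f = 1 * (f(0) k + k * h)
   everywhere, hence (k * f)' = f(0) k + k * h almost everywhere, and the outer
   operator is applied with the semigroup law
     k_{beta',gam'} * k_{beta,gam} = k_{beta'+beta,gam'+gam},
   which combines Euler's Beta integral with the Chu-Vandermonde identity.  The
   result is f(0) k + k * h for the kernel of the regularized derivative.
   The density h is the Radon-Nikodym derivative of the Stieltjes measures of
   the total variation of f and of its difference with f. *)

(** * Integration and convolution *)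

(** What shapes the proof is the difference between everywhere and almost everywhere. The identity
    for k * f is differentiated afterwards, so it must hold at every point; associativity is
    available pointwise there because the constant 1 is a bounded factor. The outer operator only
    integrates, so associativity of three merely integrable factors, valid almost everywhere,
    suffices for it. Both forms come from one statement at a single [t], under a finiteness
    condition at that [t]. Convolutions run over the whole line, between functions cut off to []0,
    b[]: the kernels are singular at 0 for beta < 1 and need not be integrable at infinity, and
    nothing is known of [f] outside [[0, b]]. At [t < b], a convolution of functions vanishing on
    the nonpositive axis sees only []0, t[]. The semigroup law multiplies two series under an
    integral. Crude estimates suffice, because Gamma outgrows every geometric sequence: the ratio of
    the dominating geometric series can be prescribed in advance. *)

Section ae_integral.
Local Open Scope ereal_scope.
Context d (T : measurableType d) (R : realType) (mu : {measure set T -> \bar R}).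

Import HBNNSimple.

(** The integral of a nonnegative function is a supremum over the simple functions below it,
    whatever the function. Multiplying such a simple function by the indicator of the complement of
    the null set keeps its integral and puts it below [g]. *)
Let ge0_le_integral_ae (f g : T -> \bar R) :
  (forall x, 0 <= f x) -> (forall x, 0 <= g x) ->
  {ae mu, forall x, f x = g x} -> \int[mu]_x f x <= \int[mu]_x g x.
Proof.
move=> f0 g0 [N [mN N0 fgN]].
rewrite ge0_integralTE// [leRHS]ge0_integralTE//.
apply: ge_ereal_sup => _ [h hf <-].
pose h' := proj_nnsfun h (measurableC mN).
have -> : sintegral mu h = sintegral mu h'.
  rewrite -!integralT_nnsfun; apply: ge0_ae_eq_integral => //.
  - exact/measurable_EFinP.
  - exact/measurable_EFinP.
  - by move=> x _; rewrite lee_fin.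
  - by move=> x _; rewrite lee_fin.
  - exists N; split => // x; apply: contra_notP => Nx _ /=.
    by rewrite mindicE mem_set// mulr1.
apply: ereal_sup_ubound; exists h' => //= x; rewrite mindicE.
have [xN|xN] := boolP (x \in ~` N); last by rewrite mulr0.
rewrite mulr1 (le_trans (hf x))//.
suff -> : f x = g x by [].
by move/set_mem: xN; apply: contra_notP => /fgN.
Qed.

(* Unlike [ae_eq_integral] this does not ask for measurability, which is not
   available for [derive1] of an absolutely continuous function. *)
Lemma ae_eq_integral_nomeas (D : set T) (f g : T -> \bar R) :
  {ae mu, forall x, D x -> f x = g x} ->
  \int[mu]_(x in D) f x = \int[mu]_(x in D) g x.
Proof.
move=> fg.
suff P (a b : T -> \bar R) : {ae mu, forall x, a x = b x} ->
    \int[mu]_x a x = \int[mu]_x b x.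
  rewrite integral_mkcond [RHS]integral_mkcond; apply: P.
  apply: filterS fg => x xfg; rewrite !patchE.
  by case: ifPn => // /set_mem.
move=> ab; rewrite integralE [RHS]integralE; congr (_ - _).
  by apply/eqP; rewrite eq_le; apply/andP; split; apply: ge0_le_integral_ae => //;
    apply: filterS ab => x abx; rewrite !funeposE abx.
by apply/eqP; rewrite eq_le; apply/andP; split; apply: ge0_le_integral_ae => //;
  apply: filterS ab => x abx; rewrite !funenegE abx.
Qed.

Lemma ae_eq_Rintegral (D : set T) (f g : T -> R) :
  {ae mu, forall x, D x -> f x = g x} ->
  (\int[mu]_(x in D) f x = \int[mu]_(x in D) g x)%R.
Proof.
move=> fg; rewrite /Rintegral; congr fine; apply: ae_eq_integral_nomeas.
by apply: filterS fg => x /= xfg Dx; rewrite xfg.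
Qed.

End ae_integral.

(** * Affine changes of variable *)

Section lebesgue_affine.
Local Open Scope ereal_scope.
Context {R : realType}.
Local Notation mu := (@lebesgue_measure R).

Let measurable_affine (c d : R) :
  measurable_fun setT ((fun x => c + d * x)%R : measurableTypeR R -> measurableTypeR R).
Proof. by apply: measurable_funD => //; exact: measurable_funM. Qed.

(** The scaled image measure agrees with Lebesgue measure on half-open intervals, and these
    determine it. *)
Lemma lebesgue_measure_affine (c d : R) (A : set R) : (0 < d)%R ->
  measurable A -> d%:E * mu ((fun x => c + d * x)%R @^-1` A) = mu A.
Proof.
move=> d0 mA.
pose phi : measurableTypeR R -> measurableTypeR R := (fun x => c + d * x)%R.
have mphi : measurable_fun setT phi := measurable_affine c d.
unshelve epose (m := (mscale (NngNum (ltW d0)) (pushforward mu phi)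
  : {measure set (measurableTypeR R) -> \bar R})); first exact: mphi.
apply/esym; rewrite (@lebesgue_measure_unique _ m)//.
move=> _ [[a b]] _ <- /=.
rewrite /m /mscale/= /pushforward/=.
have -> : phi @^-1` `]a, b] = `](a - c) / d, (b - c) / d]%classic%R.
  apply/seteqP; split => x /=; rewrite /phi !in_itv/= ltr_pdivrMr// ler_pdivlMr// => /andP[h1 h2]; apply/andP; split; lra.
rewrite !lebesgue_measure_itv/= !lte_fin ltr_pM2r ?invr_gt0// ltrD2r.
case: ifPn => _; last by rewrite mule0.
rewrite -!EFinD -EFinM; congr (_%:E); field; lra.
Qed.

Lemma ge0_integral_affine (c d : R) (f : R -> \bar R) : (0 < d)%R ->
  measurable_fun setT f -> (forall x, 0 <= f x) ->
  \int[mu]_x f x = d%:E * \int[mu]_x f (c + d * x)%R.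
Proof.
move=> d0 mf f0.
pose phi : measurableTypeR R -> measurableTypeR R := (fun x => c + d * x)%R.
have mphi : measurable_fun setT phi := measurable_affine c d.
unshelve epose (m := (mscale (NngNum (ltW d0)) (pushforward mu phi)
  : {measure set (measurableTypeR R) -> \bar R})); first exact: mphi.
transitivity (\int[m]_x f x).
  apply: eq_measure_integral => A mA _ /=.
  by rewrite /m /mscale/= /pushforward/= lebesgue_measure_affine.
rewrite ge0_integral_mscale//=; congr (_ * _).
exact: (ge0_integral_pushforward mphi mu measurableT mf (fun x _ => f0 x)).
Qed.

Lemma ge0_integral_sub (t : R) (f : R -> \bar R) :
  measurable_fun setT f -> (forall x, 0 <= f x) ->
  \int[mu]_x f (t - x)%R = \int[mu]_x f x.
Proof.
move=> mf f0.
pose g x := f (t + x)%R.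
have mg : measurable_fun setT g.
  by apply: measurableT_comp => //; exact: measurable_funD.
transitivity (\int[pushforward mu (-%R : measurableTypeR R -> measurableTypeR R)]_x g x).
  have mN : measurable_fun setT (-%R : measurableTypeR R -> measurableTypeR R).
    exact: oppr_measurable.
  apply/esym; exact: (ge0_integral_pushforward mN mu measurableT mg (fun x _ => f0 _)).
transitivity (\int[mu]_x g x).
  by apply: eq_measure_integral => A mA _; exact: lebesgue_measureN.
rewrite [RHS](@ge0_integral_affine t 1)// mul1e.
by apply: eq_integral => x _; rewrite mul1r.
Qed.

Lemma integral_sub (t : R) (f : R -> \bar R) : measurable_fun setT f ->
  \int[mu]_x f (t - x)%R = \int[mu]_x f x.
Proof.
move=> mf; rewrite integralE [RHS]integralE.
have E (g : R -> \bar R) : (forall x, 0 <= g x) -> measurable_fun setT g ->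
    \int[mu]_x g (t - x)%R = \int[mu]_x g x by move=> *; exact: ge0_integral_sub.
congr (_ - _).
  rewrite -[RHS]E//; last exact: measurable_funepos.
  by apply: eq_integral => x _; rewrite !funeposE.
rewrite -[RHS]E//; last exact: measurable_funeneg.
by apply: eq_integral => x _; rewrite !funenegE.
Qed.

End lebesgue_affine.

(** * Convolution on the real line *)

Section convolution.
Context {R : realType}.
Local Notation mu := (@lebesgue_measure R).
Local Notation T := (measurableTypeR R).
Implicit Types u v w : R -> R.

(** No endpoint depends on [t], so Fubini, translation and reflection apply directly. Where the
    integral is infinite the value is 0. *)
Definition conv u v (t : R) : R := \int[mu]_y (u (t - y) * v y).

Let measurable_sub12 : measurable_fun setT (fun p : T * T => p.1 - p.2 : T).
Proof. exact: (measurable_funB (measurable_fst : measurable_fun setT (fst : T * T -> R)) measurable_snd). Qed.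

Let measurable_sub (t : R) : measurable_fun setT (fun y : T => t - y).
Proof. exact: measurable_funB. Qed.

Let measurable_subr (y : R) : measurable_fun setT (fun t : T => t - y).
Proof. exact: measurable_funB. Qed.

Let measurable_section (f : R -> R) (t : R) : measurable_fun setT f ->
  measurable_fun setT (fun y : T => f (t - y)).
Proof. by move=> mf; exact: (measurableT_comp mf (measurable_sub t)). Qed.

Section nonnegative.
Local Open Scope ereal_scope.
Variables f g : R -> \bar R.
Hypotheses (mf : measurable_fun setT f) (mg : measurable_fun setT g).
Hypotheses (f0 : forall x, 0 <= f x) (g0 : forall x, 0 <= g x).

Lemma measurable_conv_prod :
  measurable_fun setT (fun p : T * T => f (p.1 - p.2)%R * g p.2).
Proof.
apply: emeasurable_funM.
  exact: (measurableT_comp mf measurable_sub12).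
exact: (measurableT_comp mg measurable_snd).
Qed.

Lemma measurable_ge0_conv :
  measurable_fun setT (fun t : T => \int[mu]_y (f (t - y)%R * g y)).
Proof.
apply: (measurable_fun_fubini_tonelli_F (m2 := mu)
  (fun p : T * T => f (p.1 - p.2)%R * g p.2)); first exact: measurable_conv_prod.
by move=> p; rewrite mule_ge0.
Qed.

Lemma ge0_integral_conv :
  \int[mu]_t \int[mu]_y (f (t - y)%R * g y) =
  (\int[mu]_x f x) * \int[mu]_x g x.
Proof.
rewrite (fubini_tonelli (m1 := mu) (m2 := mu)
  (fun p : T * T => f (p.1 - p.2)%R * g p.2))/=; last 2 first.
- exact: measurable_conv_prod.
- by move=> p; rewrite mule_ge0.
under eq_integral => y _.
  rewrite ge0_integralZr//; last exact: (measurableT_comp mf (measurable_subr y)).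
  have -> : \int[mu]_x f (x - y)%R = \int[mu]_x f x.
    rewrite [RHS](@ge0_integral_affine _ (- y)%R 1)// mul1e.
    by apply: eq_integral => x _; rewrite mul1r addrC.
  over.
by rewrite ge0_integralZl//; exact: integral_ge0.
Qed.

End nonnegative.

Section integrable.
Variables u v : R -> R.
Hypotheses (iu : mu.-integrable setT (EFin \o u)).
Hypotheses (iv : mu.-integrable setT (EFin \o v)).

Let mu_ : measurable_fun setT u.
Proof. by apply/measurable_EFinP; exact: measurable_int iu. Qed.
Let mv : measurable_fun setT v.
Proof. by apply/measurable_EFinP; exact: measurable_int iv. Qed.

Lemma integrable_conv_prod : (mu \x mu)%E.-integrable setT
  (fun p : T * T => (u (p.1 - p.2) * v p.2)%:E).
Proof.
apply/integrable12ltyP => /=.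
  apply/measurable_EFinP/measurable_funM.
    exact: (measurableT_comp mu_ measurable_sub12).
  exact: (measurableT_comp mv measurable_snd).
under eq_integral => x _.
  under eq_integral => y _ do rewrite normrM EFinM.
  over.
rewrite /= (@ge0_integral_conv (fun x => `|u x|%:E) (fun x => `|v x|%:E))//=.
- by apply: lte_mul_pinfty; [exact: integral_ge0| |];
    [apply/fin_numPlt; rewrite (@lt_le_trans _ _ 0%E)//= ?integral_ge0//| ];
    [case/integrableP: iu|case/integrableP: iv].
- by apply/measurable_EFinP; exact: measurableT_comp.
- by apply/measurable_EFinP; exact: measurableT_comp.
Qed.

Lemma ae_integrable_conv :
  {ae mu, forall t, mu.-integrable setT (fun y => (u (t - y) * v y)%:E)}.
Proof. exact: (ae_integrable1 integrable_conv_prod). Qed.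

Lemma integrable_conv : mu.-integrable setT (EFin \o conv u v).
Proof.
have iF := integrable_fubini_F integrable_conv_prod.
have mF := measurable_int mu iF.
have mc : measurable_fun setT (conv u v).
  by apply: measurableT_comp mF.
apply: (le_integrable measurableT _ _ iF) => [|t _].
  exact/measurable_EFinP.
(* At the points where the inner integral is infinite, [fine] gives 0, so the bound holds there
   too. *)
rewrite /= /conv /Rintegral /fubini_F /=.
by case: (integral _ _ _) => //=; rewrite ?normr0 ?leey.
Qed.

End integrable.

(** Finiteness of the absolute iterated integral at this [t] makes the double integrand integrable
    in [(y, s)], so Fubini applies at this point alone. *)
Lemma conv_assoc_at u v w t :
  measurable_fun setT u -> measurable_fun setT v -> measurable_fun setT w ->
  (\int[mu]_y (`|u (t - y)|%:E * \int[mu]_s (`|v (y - s)|%:E * `|w s|%:E))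
    < +oo)%E ->
  conv u (conv v w) t = conv (conv u v) w t.
Proof.
move=> mu_ mv mw fin.
pose F (p : T * T) : \bar R := (u (t - p.1) * (v (p.1 - p.2) * w p.2))%:E.
have iF : (mu \x mu)%E.-integrable setT F.
  apply/integrable12ltyP; first apply/measurable_EFinP/measurable_funM.
  - exact: (measurableT_comp (measurable_section t mu_) measurable_fst).
  - apply: measurable_funM; first exact: (measurableT_comp mv measurable_sub12).
    exact: (measurableT_comp mw measurable_snd).
  apply: le_lt_trans fin; rewrite le_eqVlt; apply/orP; left; apply/eqP.
  apply: eq_integral => y _.
  under eq_integral => s _ do rewrite /F/= !normrM !EFinM.
  rewrite ge0_integralZl//.
  apply: emeasurable_funM.
    apply/measurable_EFinP/measurableT_comp => //.
    exact: measurable_section.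
  exact/measurable_EFinP/measurableT_comp.
(* On a section only the product is known to be integrable; for [a = 0] this says nothing about [f],
   but both sides are then 0. *)
have EZ (a : R) (f : R -> R) :
    mu.-integrable setT (EFin \o (fun x => a * f x)) ->
    (\int[mu]_x (a * f x)%:E = (a * \int[mu]_x f x)%:E)%E.
  have [->|a0] := eqVneq a 0.
    by move=> _; under eq_integral do rewrite mul0r; rewrite integral0 mul0r.
  move=> iaf.
  have if_ : mu.-integrable setT (EFin \o f).
    have := integrableZl measurableT a^-1 iaf.
    by apply: eq_integrable => // x _ /=; rewrite -EFinM mulKf.
  by rewrite -RintegralZl// /Rintegral fineK//; exact: integrable_fin_num.
rewrite /conv /Rintegral; congr fine.
transitivity (\int[mu]_y \int[mu]_s F (y, s))%E.
  apply: ae_eq_integral_nomeas.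
  apply: filterS (ae_integrable1 iF) => y /= iFy _.
  by rewrite -(EZ _ (fun s => v (y - s) * w s)).
rewrite Fubini//.
apply: ae_eq_integral_nomeas.
apply: filterS (ae_integrable2 iF) => s /= iFs _.
have E y : F (y, s) = (w s * (u (t - y) * v (y - s)))%:E.
  by rewrite /F/= [RHS]EFinM; congr _%:E; ring.
under eq_integral do rewrite E.
rewrite (EZ _ (fun y => u (t - y) * v (y - s))); last first.
  by move: iFs; apply: eq_integrable => // y _; rewrite E.
rewrite mulrC; congr (_ * _)%:E.
rewrite /conv /Rintegral; congr fine.
(* The substitutions [y] to [t - s - y] on the right and [y] to [t - y] on the left bring both
   integrands to u(y) v(t - s - y). *)
rewrite -[RHS](@integral_sub _ (t - s)); last first.
  apply/measurable_EFinP/measurable_funM => //.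
  exact: measurable_section.
rewrite -[LHS](@integral_sub _ t); last first.
  apply/measurable_EFinP/measurable_funM; first exact: measurable_section.
  exact: (measurableT_comp mv (measurable_subr s)).
by apply: eq_integral => y _; congr (_%:E); congr (u _ * v _); ring.
Qed.

(** The absolute triple integral, as a function [H] of [t], has as its own integral the product of
    the three L1 norms; hence it is finite for almost every [t]. *)
Lemma conv_assoc_ae u v w : mu.-integrable setT (EFin \o u) ->
  mu.-integrable setT (EFin \o v) -> mu.-integrable setT (EFin \o w) ->
  {ae mu, forall t, conv u (conv v w) t = conv (conv u v) w t}.
Proof.
move=> iu iv iw.
have abs_meas (z : R -> R) : mu.-integrable setT (EFin \o z) ->
    measurable_fun setT (fun x => `|z x|%:E).
  move=> /measurable_int /measurable_EFinP mz.
  by apply/measurable_EFinP; exact: measurableT_comp.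
have abs_fin (z : R -> R) : mu.-integrable setT (EFin \o z) ->
    (\int[mu]_x `|z x|%:E \is a fin_num)%E.
  move=> /integrableP[_ h]; apply/fin_numPlt.
  by rewrite h andbT (@lt_le_trans _ _ 0%E)// integral_ge0.
pose G (t : R) := (\int[mu]_s (`|v (t - s)|%:E * `|w s|%:E))%E.
have mG : measurable_fun setT G.
  by apply: (@measurable_ge0_conv (fun x => `|v x|%:E) (fun x => `|w x|%:E)) => //;
    exact: abs_meas.
have G0 t : (0 <= G t)%E by apply: integral_ge0 => s _; rewrite mule_ge0.
pose H (t : R) := (\int[mu]_y (`|u (t - y)|%:E * G y))%E.
have iH : mu.-integrable setT H.
  apply/integrableP; split; first
    by apply: (@measurable_ge0_conv (fun x => `|u x|%:E) G) => //; exact: abs_meas.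
  under eq_integral => t _.
    rewrite gee0_abs; last by apply: integral_ge0 => y _; rewrite mule_ge0.
    over.
  rewrite /H (@ge0_integral_conv (fun x => `|u x|%:E) G)//; last exact: abs_meas.
  rewrite /G (@ge0_integral_conv (fun x => `|v x|%:E) (fun x => `|w x|%:E))//;
    [|exact: abs_meas..].
  by rewrite ltey_eq !fin_numM// abs_fin.
have := integrable_ae measurableT iH; apply: filterS => t /= /(_ I) Ht.
apply: conv_assoc_at.
- by apply/measurable_EFinP; exact: measurable_int iu.
- by apply/measurable_EFinP; exact: measurable_int iv.
- by apply/measurable_EFinP; exact: measurable_int iw.
by rewrite -/(G _) ltey_eq Ht.
Qed.

End convolution.

(** * Densities of absolutely continuous functions *)

Section chains.
Context {R : realType}.
Implicit Types (a b x y z : R) (f : R -> R) (s t : seq (R * R)).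

(* A pair [(v, u)] stands for the interval from [u] to [v], in the order that
   [variation_zip] produces. *)
Fixpoint chain x b s : bool :=
  if s is (v, u) :: s' then [&& x <= u, u <= v & chain v b s'] else x <= b.

Definition chain_len s : R := \sum_(p <- s) (p.1 - p.2).

Definition chain_var f s : R := \sum_(p <- s) `|f p.1 - f p.2|.

(** Absolute continuity tested on ordered lists instead of indexed disjoint families, so that
    intervals can be refined and concatenated by induction. *)
Definition chain_ac a b f : Prop := forall e, 0 < e -> exists2 d, 0 < d &
  forall s, chain a b s -> chain_len s < d -> chain_var f s < e.

Lemma chain_cat x y z s t : chain x y s -> chain y z t -> chain x z (s ++ t).
Proof.
elim: s x => [|[v u] s IH] x /=.
  by case: t => [|[v u] t] /= xy; [exact: le_trans|case/and3P=> yu -> ->;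
    rewrite (le_trans xy yu)].
by case/and3P => -> -> /IH /[apply] ->.
Qed.

Lemma chain_le x b s : chain x b s -> x <= b.
Proof.
elim: s x => // -[v u] s IH x /= /and3P[xu uv /IH vb].
by rewrite (le_trans xu)// (le_trans uv).
Qed.

Lemma chain_sub a b x y s : a <= x -> y <= b -> chain x y s -> chain a b s.
Proof.
move=> ax yb c; have /= := @chain_cat a x y [::] s ax c.
by move=> /(@chain_cat a y b s [::])/(_ yb); rewrite cats0.
Qed.

Lemma chain_nth x b s i : chain x b s -> (i < size s)%N ->
  [/\ x <= (nth 0 s i).2, (nth 0 s i).2 <= (nth 0 s i).1 & (nth 0 s i).1 <= b].
Proof.
elim: s x i => // -[v u] s IH x [|i] /= /and3P[xu uv c].
  by move=> _; split => //; exact: chain_le c.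
rewrite ltnS => /(IH _ _ c)[h1 h2 h3]; split => //.
by rewrite (le_trans xu)// (le_trans uv).
Qed.

Lemma chain_nth_lt x b s i j : chain x b s -> (i < j < size s)%N ->
  (nth 0 s i).1 <= (nth 0 s j).2.
Proof.
elim: s x i j => [|[v u] s IH] x i [|j] /=; do ?by [move=> _ /andP[]|rewrite ?andbF].
case/and3P=> xu uv c; case: i => [|i] /=.
  by rewrite ltnS => /(chain_nth c)[].
by rewrite !ltnS; exact: (IH v).
Qed.

Lemma absolutely_continuous_chain a b f :
  absolutely_continuous a b f -> chain_ac a b f.
Proof.
move=> ac e e0; have [d d0 fd] := ac _ e0; exists d => // s cs.
have E (g : R * R -> R) : \sum_(p <- s) g p = \sum_(i < size s) g (nth 0 s i).
  by rewrite (big_nth 0) big_mkord.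
rewrite /chain_len /chain_var !E => ld.
apply: (fd _ (fun i : 'I_(size s) => (nth 0 s i).2) (fun i => (nth 0 s i).1)) => //.
  by move=> i; exact: (chain_nth cs).
apply/trivIsetP => i j _ _ ij; rewrite -subset0 => x /= [].
rewrite !in_itv/= => /andP[ix xi] /andP[jx xj].
have : (i != j :> nat)%N by [].
rewrite neq_ltn => /orP[] lij.
  have := @chain_nth_lt a b s i j cs; rewrite lij ltn_ord => /(_ isT) h.
  by have := lt_le_trans xi (le_trans h (ltW jx)); rewrite ltxx.
have := @chain_nth_lt a b s j i cs; rewrite lij ltn_ord => /(_ isT) h.
by have := lt_le_trans xj (le_trans h (ltW ix)); rewrite ltxx.
Qed.

Lemma chain_ac_sub a b x y f : a <= x -> y <= b -> chain_ac a b f ->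
  chain_ac x y f.
Proof.
move=> ax yb ac e e0; have [d d0 fd] := ac _ e0; exists d => // s.
by move/(chain_sub ax yb); exact: fd.
Qed.

Lemma chain_acB a b f g : chain_ac a b f -> chain_ac a b g ->
  chain_ac a b (fun x => f x - g x).
Proof.
move=> acf acg e e0; have e20 : 0 < e / 2 by rewrite divr_gt0.
have [d d0 fd] := acf _ e20; have [d' d'0 gd] := acg _ e20.
exists (Num.min d d'); first by rewrite lt_min d0.
move=> s cs; rewrite lt_min => /andP[/(fd _ cs) fe /(gd _ cs) ge].
apply: (@le_lt_trans _ _ (chain_var f s + chain_var g s)); last first.
  by rewrite [ltRHS](splitr e) ltrD.
rewrite /chain_var -big_split/=; apply: ler_sum => p _.
have -> : f p.1 - g p.1 - (f p.2 - g p.2) = (f p.1 - f p.2) - (g p.1 - g p.2).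
  by ring.
exact: ler_normB.
Qed.

Lemma chain_ac1 a b f : chain_ac a b f -> forall e, 0 < e ->
  exists2 d, 0 < d & forall x y, a <= x -> x <= y -> y <= b -> y - x < d ->
  `|f y - f x| < e.
Proof.
move=> ac e e0; have [d d0 fd] := ac _ e0; exists d => // x y ax xy yb xyd.
have := fd [:: (y, x)]; rewrite /chain_len /chain_var !big_seq1/= ax xy yb.
by apply.
Qed.

Lemma itv_partition_chain a b (s : seq R) : itv_partition a b s ->
  chain a b (zip s (a :: s)) /\ chain_len (zip s (a :: s)) = b - a.
Proof.
rewrite /chain_len; elim: s a => [|h t IH] a.
  by move=> /itv_partition_nil ->; rewrite /= big_nil subrr.
move=> p; have [c l] := IH _ (itv_partition_cons p).
have [/= /andP[ah _] _] := p.
by rewrite big_cons/= l c lexx ltW//; split => //; ring.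
Qed.

(** With [d] chosen for the tolerance 1, the variation over any interval shorter than [d] is at most
    1; [[a, b]] is cut into [N] such intervals. *)
Lemma chain_ac_TV_fin a b f : a <= b -> chain_ac a b f ->
  total_variation a b f \is a fin_num.
Proof.
move=> ab ac; have [d d0 fd] := ac _ ltr01.
have small x y : a <= x -> x <= y -> y <= b -> y - x < d ->
    total_variation x y f \is a fin_num.
  move=> ax xy yb xyd; rewrite ge0_fin_numE ?total_variation_ge0//.
  apply: (@le_lt_trans _ _ 1%E); last exact: ltry.
  apply: ge_ereal_sup => _ [_ [s ps <-] <-]; rewrite lee_fin variation_zip//.
  have [c l] := itv_partition_chain ps.
  by apply/ltW/fd; [exact: chain_sub c|rewrite l].
pose N := Num.bound ((b - a) / d).
have N0 : (0 < N)%N.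
  rewrite -(ltr_nat R); apply: le_lt_trans (archi_boundP _);
  by rewrite divr_ge0 ?subr_ge0// ltW.
have N0' : 0 < N%:R :> R by rewrite ltr0n.
have hd : (b - a) / N%:R < d.
  rewrite ltr_pdivrMr// mulrC -ltr_pdivrMr//; apply: archi_boundP; by rewrite divr_ge0 ?subr_ge0// ltW.
have h0 : 0 <= (b - a) / N%:R by rewrite divr_ge0 ?subr_ge0.
suff H k : (k <= N)%N ->
    total_variation a (a + (b - a) / N%:R * k%:R) f \is a fin_num.
  by have := H _ (leqnn N); rewrite divfK ?gt_eqF// subrKC.
elim: k => [_|k IH kN]; first by rewrite mulr0 addr0 total_variationxx.
have ak : a <= a + (b - a) / N%:R * k%:R by rewrite lerDl mulr_ge0.
have kk : a + (b - a) / N%:R * k%:R <= a + (b - a) / N%:R * k.+1%:R.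
  by rewrite lerD2l ler_wpM2l// ler_nat.
rewrite (total_variationD f ak kk) fin_numD IH/= ?(ltnW kN)//.
apply: small => //.
  rewrite addrC -lerBrDr mulrAC ler_pdivrMr// ler_wpM2l ?subr_ge0//.
  by rewrite ler_nat.
by rewrite -natr1; apply: le_lt_trans hd; rewrite le_eqVlt; apply/orP; left; apply/eqP; ring.
Qed.

Lemma total_variation_chain a b f e : a <= b -> 0 < e ->
  total_variation a b f \is a fin_num -> exists2 s, chain a b s &
    chain_len s = b - a /\ fine (total_variation a b f) <= chain_var f s + e.
Proof.
move=> ab e0 TVf.
have [_ [_ [s ps <-] <-]] := ub_ereal_sup_adherent e0 TVf.
rewrite -/(total_variation a b f) variation_zip// => h.
have [c l] := itv_partition_chain ps.
exists (zip s (a :: s)) => //; split => //.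
by rewrite -lerBlDr ltW// -lte_fin EFinB fineK.
Qed.

Section TV.
Variables (a b : R) (f : R -> R).
Hypotheses (ab : a <= b) (ac : chain_ac a b f).

Let F x := fine (total_variation a x f).

Lemma TV_fin x y : a <= x -> x <= y -> y <= b ->
  total_variation x y f \is a fin_num.
Proof.
by move=> ax xy yb; apply: chain_ac_TV_fin => //; exact: chain_ac_sub ac.
Qed.

Lemma fine_TVB x y : a <= x -> x <= y -> y <= b ->
  F y - F x = fine (total_variation x y f).
Proof.
move=> ax xy yb; rewrite /F (total_variationD f ax xy) fineD ?TV_fin//.
  by rewrite addrC addKr.
exact: le_trans yb.
Qed.

Lemma fine_TV_ge x y : a <= x -> x <= y -> y <= b ->
  `|f y - f x| <= F y - F x.
Proof.
move=> ax xy yb; rewrite fine_TVB// -lee_fin fineK ?TV_fin//.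
exact: total_variation_ge.
Qed.

(** Each interval is replaced by a partition on which [f] attains its variation up to [e];
    partitioning leaves the total length unchanged. *)
Let refine_chain e x s : 0 < e -> a <= x -> chain x b s ->
  exists2 s', chain x b s' & chain_len s' = chain_len s /\
    chain_var F s <= chain_var f s' + e * (size s)%:R.
Proof.
move=> e0; elim: s x => [|[v u] s IH] x ax /=.
  by move=> xb; exists [::] => //; rewrite mulr0 addr0 /chain_var !big_nil.
case/and3P=> xu uv c; have vb := chain_le c.
have au := le_trans ax xu; have av := le_trans au uv.
have [s' c' [l' v']] := IH _ av c.
have [t ct [lt vt]] := total_variation_chain uv e0 (TV_fin au uv vb).
exists (t ++ s'); first exact: chain_cat (chain_sub xu (lexx _) ct) c'.
rewrite /chain_len /chain_var !big_cat !big_cons/= -!/(chain_len _) l' lt; split => //.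
rewrite -!/(chain_var _ _) fine_TVB// ger0_norm; last first.
  by apply: fine_ge0; exact: total_variation_ge0.
rewrite -natr1 mulrDr mulr1.
by move: vt v'; set A := fine _; set B := chain_var _ _; set C := chain_var _ _; lra.
Qed.

(** The [d] of [f] at tolerance [e / 2] also serves the variation: refining does not change the
    length, and an error of [e / 2] divided by [(size s).+1] per interval adds up to at most
    [e / 2]. *)
Lemma chain_ac_TV : chain_ac a b F.
Proof.
move=> e e0; have e20 : 0 < e / 2 by rewrite divr_gt0.
have [d d0 fd] := ac e20; exists d => // s cs ld.
have k0 : 0 < (size s).+1%:R :> R by rewrite ltr0n.
have [s' cs' [l' v']] := refine_chain (divr_gt0 e20 k0) (lexx a) cs.
have := fd _ cs'; rewrite l' => /(_ ld) h.
apply: (le_lt_trans v'); rewrite [ltRHS](splitr e) ltr_leD//.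
by rewrite mulrAC ler_pdivrMr// ler_wpM2l ?ler_nat// ltW.
Qed.

End TV.

End chains.

(** * Stieltjes measures of absolutely continuous functions *)

Section stieltjes.
Context {R : realType}.
Local Notation mu := (@lebesgue_measure R).
Local Notation T := (measurableTypeR R).
Implicit Types (a b : R) (s : seq (R * R)).

Lemma stieltjes_itvoc (F : cumulative R R) (x y : R) : x <= y ->
  lebesgue_stieltjes_measure F (`]x, y]%classic : set T) = (F y - F x)%:E.
Proof.
move=> xy; rewrite /lebesgue_stieltjes_measure/= /measure_extension/=.
rewrite measurable_mu_extE; last exact: is_ocitv.
exact: wlength_itv_bnd.
Qed.

(** Half-open intervals keep consecutive links disjoint, and a Stieltjes measure is given on them by
    increments. *)
Fixpoint chain_set s : set R :=
  if s is (v, u) :: s' then `]u, v]%classic `|` chain_set s' else set0.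

Lemma measurable_chain_set s : measurable (chain_set s : set T).
Proof. by elim: s => //= -[v u] s IH; exact: measurableU. Qed.

Lemma chain_set_itv a b s : chain a b s -> chain_set s `<=` `]a, b]%classic.
Proof.
elim: s a => [|[v u] s IH] a /=; first by move=> _ x.
case/and3P=> au uv c x [|/(IH _ c)] /=;
  rewrite !in_itv/= => /andP[h1 h2]; apply/andP; split.
- exact: le_lt_trans h1.
- exact: le_trans (chain_le c).
- exact: le_lt_trans (le_trans au uv) h1.
- by [].
Qed.

Lemma sub_chain_set s p : p \in s -> `]p.2, p.1]%classic `<=` chain_set s.
Proof.
elim: s => [//|[v u] s IH]; rewrite inE => /predU1P[->|/IH h] x hx; first by left.
by right; exact: h.
Qed.

Lemma chain_set_sub s (U : set R) :
  (forall p, p \in s -> `]p.2, p.1]%classic `<=` U) -> chain_set s `<=` U.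
Proof.
elim: s => [_ x //|[v u] s IH] h x /= [|]; first by apply: (h (v, u)); rewrite mem_head.
by apply: IH => p ps; apply: h; rewrite inE ps orbT.
Qed.

Lemma stieltjes_chain_set (F : cumulative R R) a b s : chain a b s ->
  lebesgue_stieltjes_measure F (chain_set s) =
  (\sum_(p <- s) (F p.1 - F p.2))%:E.
Proof.
elim: s a => [|[v u] s IH] a /=; first by rewrite measure0 big_nil.
case/and3P=> au uv c.
rewrite big_cons/= EFinD -(IH _ c) -(stieltjes_itvoc F uv).
apply: measureU; [by []|exact: measurable_chain_set|].
rewrite -subset0 => x [/=] + /(chain_set_itv c) /=.
by rewrite !in_itv/= => /andP[_ xv] /andP[vx _]; have := le_lt_trans xv vx; rewrite ltxx.
Qed.

Lemma lebesgue_chain_set a b s : chain a b s ->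
  mu (chain_set s) = (chain_len s)%:E.
Proof. exact: (@stieltjes_chain_set idfun). Qed.

Lemma chain_grid (w : nat -> R) (P : pred nat) b m k :
  {homo w : i j / (i <= j)%N >-> i <= j} -> w (m + k)%N <= b ->
  chain (w m) b [seq (w i.+1, w i) | i <- iota m k & P i].
Proof.
move=> ndw; elim: k m => [|k IH] m; first by rewrite addn0.
rewrite addnS -addSn => wb; rewrite /=.
have := IH _ wb; case: ifPn => _ /= c.
  by rewrite lexx ndw.
by have /= := @chain_cat _ (w m) (w m.+1) b [::] _ (ndw _ _ (leqnSn m)) c.
Qed.

Section absolutely_continuous.
Variables (a b : R) (F : cumulative R R).
Hypotheses (ab : a < b) (ac : chain_ac a b F).

Let nu := lebesgue_stieltjes_measure F.

Let w n i : R := a + (b - a) * i%:R / n.+1%:R.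

Let ndw n : {homo w n : i j / (i <= j)%N >-> i <= j}.
Proof.
move=> i j ij; rewrite /w lerD2l ler_pM2r ?invr_gt0 ?ltr0n//.
by rewrite ler_pM2l ?subr_gt0// ler_nat.
Qed.

(** A finite chain approximating an open set from inside, since absolute continuity speaks of finite
    chains only. *)
Let cells (U : set R) n := [seq (w n i.+1, w n i) |
  i <- iota 0 n.+1 & `[< `]w n i, w n i.+1]%classic `<=` U >] ].

Let chain_cells U n : chain a b (cells U n).
Proof.
have -> : a = w n 0 by rewrite /w mulr0 mul0r addr0.
apply: chain_grid; first exact: ndw.
by rewrite /w add0n mulfK ?pnatr_eq0// subrKC.
Qed.

Let cells_sub U n : chain_set (cells U n) `<=` U.
Proof.
by apply: chain_set_sub => p /mapP[i]; rewrite mem_filter => /andP[/asboolP h _] ->.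
Qed.

(* Any point of an open set lies in a grid cell inside that set, once the mesh
   is small enough. *)
Let cells_near U x : open U -> U x -> `]a, b]%classic x ->
  exists n, forall m, (n <= m)%N -> chain_set (cells U m) x.
Proof.
move=> oU Ux; rewrite /= in_itv/= => /andP[ax xb].
have [r /= r0 rU] := open_subball oU Ux.
pose n := Num.bound ((b - a) / (r / 4)).
exists n => m nm.
have r40 : 0 < r / 4 by lra.
have m0 : 0 < m.+1%:R :> R by rewrite ltr0n.
have mesh i : w m i.+1 - w m i < r / 4.
  rewrite /w -natr1 (_ : _ - _ = (b - a) / m.+1%:R); last by rewrite mulrDr mulr1 mulrDl; ring.
  rewrite ltr_pdivrMr// mulrC -ltr_pdivrMr//.
  apply: lt_trans (archi_boundP _) _; first by rewrite divr_ge0// ltW// subr_gt0.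
  by rewrite ltr_nat ltnS.
have ex : exists i, x <= w m i.
  by exists m.+1; rewrite /w mulfK ?gt_eqF// subrKC.
have := ex_minnP ex; case=> k xk kmin.
have km : (k <= m.+1)%N by apply: kmin; rewrite /w mulfK ?gt_eqF// subrKC.
case: k xk kmin km => [|k] xk kmin km.
  by move: xk; rewrite /w mulr0 mul0r addr0 leNgt ax.
have kx : w m k < x by rewrite ltNge; apply/negP => /kmin; rewrite ltnn.
apply: (@sub_chain_set _ (w m k.+1, w m k)); last by rewrite /= in_itv/= kx.
apply/mapP; exists k => //; rewrite mem_filter mem_iota/= add0n km andbT.
apply/asboolP => y /=; rewrite in_itv/= => /andP[ky yk].
have mk := mesh k.
apply: (rU (r / 2)).
- by rewrite /= /ball_ sub0r normrN gtr0_norm; lra.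
- by lra.
- by rewrite /ball/= /ball_/= ltr_norml; apply/andP; split; lra.
Qed.

(** Outer regularity encloses [N] in an open set of length below [d]. Every chain of grid cells
    inside it is then shorter than [d] and has [nu]-measure at most [e], and continuity from below
    carries this bound over to [N]. *)
Lemma stieltjes_ac_null (N : set T) : measurable N -> mu N = 0%E ->
  nu (N `&` `]a, b]%classic) = 0%E.
Proof.
move=> mN N0; apply/eqP; rewrite eq_le measure_ge0 andbT.
apply/lee_addgt0Pr => e e0; rewrite add0e.
have [d d0 fd] := ac e0.
have fN : (mu N < +oo)%E by rewrite N0 ltry.
have [U [oU NU UN]] := lebesgue_regularity_outer mN fN d0.
have mU : measurable (U : set T) by exact: open_measurable.
have Ud : (mu U < d%:E)%E.
  apply: le_lt_trans UN.
  have -> : U = N `|` (U `\` N) by rewrite setDUK.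
  rewrite (le_trans (measureU2 _ _ _))//; first exact: measurableD.
  by rewrite [X in (X + _)%E](_ : _ = 0%E)// add0e setDUK.
have nuc n : (nu (chain_set (cells U n)) <= e%:E)%E.
  have c := chain_cells U n.
  rewrite /nu (stieltjes_chain_set F c) lee_fin.
  apply: le_trans (ltW (fd _ c _)).
    by apply: ler_sum => p _; exact: ler_norm.
  rewrite -lte_fin; apply: le_lt_trans Ud.
  rewrite -(lebesgue_chain_set c); apply: le_measure; rewrite ?inE//.
  exact: measurable_chain_set.
(* The grids are not nested, so the cells need not increase with [n]. The tail intersections do
   increase, and their union still covers the part of [N] in []a, b]]. *)
pose V n := \bigcap_(m in [set m | (n <= m)%N]) chain_set (cells U m).
have mV n : measurable (V n : set T).
  apply: bigcap_measurable; first by exists n => /=.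
  by move=> *; exact: measurable_chain_set.
have mVU : measurable (\bigcup_n V n : set T) by exact: bigcup_measurable.
have NV : N `&` `]a, b]%classic `<=` \bigcup_n V n.
  by move=> x [Nx abx]; have [n h] := cells_near oU (NU _ Nx) abx; exists n.
apply: le_trans (_ : nu (\bigcup_n V n) <= _)%E.
  by apply: le_measure => //; rewrite inE//; exact: measurableI.
have cV : (nu \o V) n @[n --> \oo] --> nu (\bigcup_n V n).
  apply: nondecreasing_cvg_mu => // m n mn; apply/subsetPset => x h k /= nk.
  by apply: h => /=; exact: leq_trans nk.
rewrite -(cvg_lim _ cV)//; apply: lime_le; first by apply/cvg_ex; eexists; exact: cV.
near=> n; apply: le_trans (nuc n); rewrite /=.
apply: le_measure; rewrite ?inE//; first exact: measurable_chain_set.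
by move=> x; apply => /=.
Unshelve. all: by end_near. Qed.

(** Restricting the measure to []a, b]] makes it finite and confines it to where [F] is absolutely
    continuous; it is then dominated by Lebesgue measure. *)
Lemma stieltjes_ac_density : exists2 h : R -> R,
  mu.-integrable setT (EFin \o h) &
  forall x, a <= x <= b -> F x - F a = \int[mu]_(y in `]a, x]) h y.
Proof.
have mab : measurable (`]a, b]%classic : set T) by [].
have fin : (nu `]a, b]%classic < +oo)%E by rewrite /nu stieltjes_itvoc ?ltry// ltW.
pose m : {finite_measure set T -> \bar R} := mfrestr mab fin.
have mdom : m `<< mu.
  apply/null_content_dominatesP => A mA A0.
  by rewrite /m /= /mfrestr /mrestr; exact: stieltjes_ac_null.
have [h [h0 hfin ih mh]] := radon_nikodym_sigma_finite mdom.
exists (fine \o h).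
  by apply: eq_integrable ih => // x _ /=; rewrite fineK.
move=> x /andP[ax xb].
have := mh `]a, x]%classic (measurable_itv _).
rewrite /m /= /mfrestr /mrestr setIidl; last first.
  by move=> y /=; rewrite !in_itv/= => /andP[-> /le_trans ->].
rewrite /nu stieltjes_itvoc// => E.
by rewrite /Rintegral; under eq_integral do rewrite /= fineK//; rewrite -E.
Qed.

End absolutely_continuous.

End stieltjes.

(** * Absolutely continuous functions as primitives *)

Section density.
Context {R : realType}.
Local Notation mu := (@lebesgue_measure R).
Local Notation T := (measurableTypeR R).
Implicit Types (a b c x : R) (f h : R -> R).

Section clamp.
Variables (a b : R) (F : R -> R).
Hypotheses (ab : a <= b) (ac : chain_ac a b F).
Hypothesis ndF : {in `[a, b] &, nondecreasing_fun F}.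

Let clamp x : R := Num.max a (Num.min x b).

Let clamp_ge x : a <= clamp x. Proof. by rewrite le_max lexx. Qed.

Let clamp_le x : clamp x <= b. Proof. by rewrite ge_max ab ge_min lexx orbT. Qed.

Let clamp_id x : a <= x <= b -> clamp x = x.
Proof. by case/andP => ax xb; rewrite /clamp min_l// max_r. Qed.

Let clampB x y : x <= y -> clamp x <= clamp y <= clamp x + (y - x).
Proof.
move=> xy.
have maxB u v : u <= v -> Num.max a u <= Num.max a v <= Num.max a u + (v - u).
  by move=> uv; case: (leP a u) => ?; case: (leP a v) => ?; apply/andP; split; lra.
have minB : Num.min x b <= Num.min y b <= Num.min x b + (y - x).
  by case: (leP x b) => ?; case: (leP y b) => ?; apply/andP; split; lra.
have /andP[m1 m2] := minB; have /andP[M1 M2] := maxB _ _ m1.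
by rewrite M1 (le_trans M2)// lerD2l lerBlDl.
Qed.

(** A Stieltjes measure asks for a monotone right-continuous function on the whole line, whereas [F]
    is controlled on [[a, b]] only; it is extended by its two end values. *)
Definition clamped : R -> R := F \o clamp.

Let clampedE x : a <= x <= b -> clamped x = F x.
Proof. by move=> h; congr F; exact: clamp_id. Qed.

Let clamped_nd : {homo clamped : x y / x <= y}.
Proof.
move=> x y /clampB/andP[xy _].
have inab z : clamp z \in `[a, b] by rewrite in_itv/= clamp_ge clamp_le.
exact: (ndF (inab x) (inab y) xy).
Qed.

Let clamped_rc : right_continuous clamped.
Proof.
apply: right_continuousW => x; apply/(@cvgrPdist_lt _ R^o) => e e0.
have [d d0 fd] := chain_ac1 ac e0.
near=> y.
have xyd : `|x - y| < d by near: y; exact: (@cvgr_dist_lt _ R^o).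
have [xy|yx] := leP x y.
  rewrite distrC; apply: fd; rewrite ?clamp_ge ?clamp_le//.
    by case/andP: (clampB xy).
  by move: xyd; rewrite distrC ger0_norm ?subr_ge0//; case/andP: (clampB xy); lra.
apply: fd; rewrite ?clamp_ge ?clamp_le//.
  by case/andP: (clampB (ltW yx)).
by move: xyd; rewrite gtr0_norm ?subr_gt0//; case/andP: (clampB (ltW yx)); lra.
Unshelve. all: by end_near. Qed.

HB.instance Definition _ :=
  isCumulative.Build R _ R clamped clamped_nd clamped_rc.

Lemma nondecreasing_chain_ac_density : a < b -> exists2 h,
  mu.-integrable setT (EFin \o h) &
  forall x, a <= x <= b -> F x - F a = \int[mu]_(y in `]a, x]) h y.
Proof.
move=> ltab.
have acF : chain_ac a b clamped.
  move=> e e0; have [d d0 fd] := ac e0; exists d => // s cs ld.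
  suff -> : chain_var clamped s = chain_var F s by exact: fd.
  move: cs; rewrite /chain_var; have := lexx a; move: {-1}a => u.
  elim: s u {ld} => [|[z y] s IH] u au /=; first by rewrite !big_nil.
  case/and3P=> uy yz c; rewrite !big_cons/= (IH z)//; last first.
    exact: le_trans (le_trans au uy) yz.
  have zb := chain_le c; have ay := le_trans au uy.
  by rewrite !clampedE ?ay ?zb ?(le_trans ay yz) ?(le_trans yz zb).
have [h ih Fh] := stieltjes_ac_density ltab acF.
exists h => // x axb; rewrite -(Fh _ axb) -(clampedE axb).
by congr (_ - _); apply/esym/clampedE; rewrite lexx.
Qed.

End clamp.

(** Jordan decomposition: [f] is [F] minus [F - f]. An increment of [f] is bounded by that of its
    variation [F], so both parts are nondecreasing, and both are absolutely continuous. *)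
Lemma absolutely_continuous_density a b f : a < b ->
  absolutely_continuous a b f -> exists2 h, mu.-integrable setT (EFin \o h) &
  forall x, a <= x <= b -> f x = f a + \int[mu]_(y in `]a, x]) h y.
Proof.
move=> ab /absolutely_continuous_chain ac.
pose F x := fine (total_variation a x f).
have acF : chain_ac a b F by exact: chain_ac_TV ac.
have FB x y : a <= x -> x <= y -> y <= b -> `|f y - f x| <= F y - F x.
  by move=> ax xy yb; exact: (fine_TV_ge ac ax xy yb).
have ndF : {in `[a, b] &, nondecreasing_fun F}.
  move=> x y; rewrite !in_itv/= => /andP[ax _] /andP[_ yb] xy.
  by rewrite -subr_ge0; apply: le_trans (FB _ _ ax xy yb).
have ndG : {in `[a, b] &, nondecreasing_fun (fun x => F x - f x)}.
  move=> x y; rewrite !in_itv/= => /andP[ax _] /andP[_ yb] xy.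
  by have := le_trans (ler_norm _) (FB _ _ ax xy yb); lra.
have [hF iF hFE] := nondecreasing_chain_ac_density (ltW ab) acF ndF ab.
have [hG iG hGE] :=
  nondecreasing_chain_ac_density (ltW ab) (chain_acB acF ac) ndG ab.
exists (fun x => hF x - hG x).
  exact: (integrableB measurableT iF iG).
move=> x axb; rewrite RintegralB//; last 2 first.
- exact: integrableS iF.
- exact: integrableS iG.
by rewrite -hFE// -hGE//; ring.
Qed.

Lemma absolutely_continuous_cvg_right a b f : a < b ->
  absolutely_continuous a b f -> f x @[x --> a^'+] --> f a.
Proof.
move=> ab /absolutely_continuous_chain ac.
apply/(@cvgrPdist_lt _ R^o) => e e0; have [d d0 fd] := chain_ac1 ac e0.
near=> x; rewrite distrC; apply: fd; rewrite ?lexx//.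
  by near: x; exact: nbhs_right_ltW.
by near: x; exact: nbhs_right_ltDr.
Unshelve. all: by end_near. Qed.

(** This is Lebesgue differentiation; the formula for [f] is asked only inside the interval because
    the derivative at an inner point is local. *)
Lemma ae_derive1_primitive a b c f h : mu.-integrable setT (EFin \o h) ->
  (forall x, a < x < b -> f x = c + \int[mu]_(y in `]a, x]) h y) ->
  {ae mu, forall x, a < x < b -> derive1 f x = h x}.
Proof.
move=> ih fE.
have ihl y : mu.-integrable [set` Interval (BRight a) (BRight y)] (EFin \o h).
  exact: integrableS ih.
have lh : locally_integrable [set: R] h.
  exact: (open_integrable_locally openT ih).
have := FTC1 ihl lh.
apply: filterS; first exact: (ae_filter_ringOfSetsType mu).
move=> x /= H /andP[ax xb].
have [|dF <-] := H; first by rewrite lte_fin.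
rewrite !derive1E.
rewrite (@near_eq_derive _ _ _ _
  (cst c + (fun y => \int[mu]_(t in `]a, y]) h t))); last first.
  near=> y; rewrite fE//; apply/andP; split.
    by near: y; exact: lt_nbhsr.
  by near: y; exact: lt_nbhsl.
by rewrite deriveD// derive_cst add0r.
Unshelve. all: by end_near. Qed.

End density.

(** * The Gamma function *)

Section gamma.
Context {R : realType}.
Local Notation mu := (@lebesgue_measure R).
Local Notation T := (measurableTypeR R).
Implicit Types (a b c x t : R).

(* The power function cut off on the nonpositive axis, where [powR] takes the
   value [1]. *)
Definition ppow c x : R := if 0 < x then x `^ c else 0.

Lemma ppow_ge0 c x : 0 <= ppow c x.
Proof. by rewrite /ppow; case: ifP => // _; exact: powR_ge0. Qed.

Lemma ppow_gt0E c x : 0 < x -> ppow c x = x `^ c.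
Proof. by rewrite /ppow => ->. Qed.

Lemma ppow_le0 c x : x <= 0 -> ppow c x = 0.
Proof. by rewrite /ppow leNgt => /negbTE ->. Qed.

Lemma ppowM c x y : 0 < x -> ppow c (x * y) = x `^ c * ppow c y.
Proof.
move=> x0; rewrite /ppow pmulr_rgt0//; case: ifP => y0; last by rewrite mulr0.
by rewrite powRM// ltW.
Qed.

Lemma measurable_ppow c : measurable_fun setT (ppow c : R -> R).
Proof.
apply: measurable_fun_ifT => //; exact: measurable_fun_ltr.
Qed.

(** Euler's integrand extended by 0 to the line, so that it can be convolved. *)
Let gexp a x : R := ppow (a - 1) x * expR (- x).

Let gexp_ge0 a x : 0 <= gexp a x.
Proof. by rewrite mulr_ge0 ?ppow_ge0 ?expR_ge0. Qed.

Let measurable_expRN : measurable_fun setT (fun x : R => expR (- x)).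
Proof. by apply: measurableT_comp => //; exact: measurable_funN. Qed.

Let measurable_gexp a : measurable_fun setT (gexp a).
Proof. by apply: measurable_funM => //; exact: measurable_ppow. Qed.

Let GammaEpatch a : Gamma a = \int[mu]_x gexp a x.
Proof.
rewrite /Gamma Rintegral_mkcond; apply: eq_Rintegral => x _.
rewrite patchE /gexp /ppow; case: ifPn => [|].
  by rewrite inE/= in_itv/= andbT => ->.
by rewrite notin_setE/= in_itv/= andbT => /negP/negbTE ->; rewrite mul0r.
Qed.

(** For [a < 1] the integrand is singular at 0: the fundamental theorem of calculus is applied on
    [[1/(k+1), 1]], and monotone convergence keeps the bound. *)
Lemma integral_ppow01 a : 0 < a ->
  (\int[mu]_(x in `]0%R, 1%R]) (ppow (a - 1) x)%:E <= (a^-1)%:E)%E.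
Proof.
move=> a0; rewrite itv_open_bnd_bigcup.
pose S (k : nat) : set T := `[0 + k.+1%:R^-1, 1 : R]%classic.
have nd : nondecreasing_seq S.
  move=> m n mn; apply/subsetPset => x /=; rewrite /S/= !in_itv/= => /andP[h ->].
  by rewrite andbT (le_trans _ h)// lerD2l lef_pV2 ?posrE ?ltr0n// ler_nat.
have mS k : measurable (S k) by exact: measurable_itv.
have mp k : measurable_fun (S k) (fun x => (ppow (a - 1) x)%:E).
  by apply: measurable_funTS; apply/measurable_EFinP; exact: measurable_ppow.
have pp k x : S k x -> (0 <= (ppow (a - 1) x)%:E)%E.
  by move=> _; rewrite lee_fin ppow_ge0.
have cv := @ge0_nondecreasing_set_cvg_integral _ _ _ S _ mu nd mS mp pp.
rewrite -(cvg_lim _ cv)//.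
apply: lime_le; first by apply/cvg_ex; eexists; exact: cv.
near=> n; rewrite /S/= add0r; set e := n.+1%:R^-1.
have e0 : 0 < e by rewrite invr_gt0 ltr0n.
have e1 : e < 1 by rewrite invf_lt1 ?ltr0n// ltr1n ltnS; near: n; exists 1%N.
have dp c x : 0 < x -> derivable (fun y : R => y `^ c) x 1.
  by move=> x0; apply: derivable_powR; rewrite in_itv/= x0.
pose F x := a^-1 *: (x `^ a : R^o).
have dF x : 0 < x -> derivable F x 1 by move=> x0; apply: derivableZ; exact: dp.
have cF x : 0 < x -> {for x, continuous F}.
  by move=> x0; apply/differentiable_continuous/derivable1_diffP; exact: dF.
have -> : (\int[mu]_(x in `[e, 1%R]) (ppow (a - 1) x)%:E =
    \int[mu]_(x in `[e, 1%R]) (x `^ (a - 1))%:E)%E.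
  apply: eq_integral => x /[!inE]/=; rewrite in_itv/= => /andP[ex _].
  by rewrite ppow_gt0E// (lt_le_trans e0).
rewrite (@continuous_FTC2 _ _ F)//.
- rewrite /F powR1 -EFinB lee_fin [_ *: _]mulr1 gerBl//.
  by apply: mulr_ge0; [rewrite invr_ge0 ltW|exact: powR_ge0].
- apply: derivable_within_continuous => x; rewrite in_itv/= => /andP[ex _].
  by apply: dp; exact: lt_le_trans ex.
- split.
  + by move=> x; rewrite in_itv/= => /andP[ex _]; apply: dF; exact: lt_trans ex.
  + by apply: cvg_at_right_filter; exact: cF.
  + by apply: cvg_at_left_filter; exact: cF.
- move=> x; rewrite in_itv/= => /andP[ex _]; have x0 := lt_trans e0 ex.
  rewrite derive1E deriveZ; last exact: dp.
  rewrite -derive1E powR_derive1 ?in_itv/= ?x0//.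
  by rewrite [_ *: _]mulrA mulVf ?mul1r// gt_eqF.
Unshelve. all: by end_near. Qed.

(** Beyond 1, the inequality y <= exp y at y = x / (2a), raised to the power [a], gives x^a <=
    (2a)^a exp(x/2), which leaves exp(-x/2). The leading 2 cancels the rate 1/2 in the exponential
    density. *)
Let gexp_le a x : 0 < a -> 0 < x ->
  gexp a x <= (ppow (a - 1) \_ `]0, 1]) x
              + 2 * (2 * a) `^ a * exponential_pdf 2^-1 x.
Proof.
move=> a0 x0; rewrite exponential_pdfE ?(ltW x0)//.
have [x1|x1] := leP x 1.
  rewrite patchE ifT; last by rewrite inE/= in_itv/= x0.
  apply: (@le_trans _ _ (ppow (a - 1) x)).
    by rewrite /gexp ler_piMr ?ppow_ge0// -expR0 ler_expR oppr_le0 ltW.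
  by rewrite lerDl !mulr_ge0// ?powR_ge0 ?expR_ge0 ?invr_ge0.
rewrite patchE ifF; last first.
  by apply/negP; rewrite inE/= in_itv/= x0/= leNgt x1.
rewrite add0r /gexp ppow_gt0E//.
have h1 : x `^ (a - 1) <= x `^ a by apply: ler_powR; [exact: ltW|lra].
have h2 : x `^ a <= (2 * a) `^ a * expR (x / 2).
  have -> : x / 2 = x / (2 * a) * a by field; lra.
  rewrite expRM -powRM ?expR_ge0//; last by lra.
  apply: ge0_ler_powR; rewrite ?nnegrE ?(ltW a0) ?(ltW x0)//.
    by rewrite mulr_ge0 ?expR_ge0//; lra.
  have := expR_ge1Dx (x / (2 * a)); rewrite -(ler_pM2l (_ : 0 < 2 * a)); last by lra.
  rewrite mulrDr mulr1 mulrCA divff ?mulr1; last by lra.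
  by lra.
apply: (@le_trans _ _ ((2 * a) `^ a * expR (x / 2) * expR (- x))).
  by rewrite ler_wpM2r ?expR_ge0// (le_trans h1).
rewrite -mulrA -expRD (_ : x / 2 - x = - 2^-1 * x); last by field.
rewrite le_eqVlt; by apply/orP; left; apply/eqP; field.
Qed.

Lemma integrable_gexp a : 0 < a -> mu.-integrable setT (EFin \o gexp a).
Proof.
move=> a0.
pose D := 2 * (2 * a) `^ a.
have D0 : 0 <= D by rewrite mulr_ge0// powR_ge0.
have i1 : mu.-integrable setT (EFin \o (ppow (a - 1) \_ `]0, 1])).
  rewrite -restrict_EFin; apply/integrable_restrict => //; rewrite setTI.
  apply/integrableP; split.
    by apply: measurable_funTS; apply/measurable_EFinP; exact: measurable_ppow.
  apply: le_lt_trans (ltry a^-1); apply: le_trans (integral_ppow01 a0).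
  rewrite le_eqVlt; apply/orP; left; apply/eqP.
  by apply: eq_integral => x _ /=; rewrite ger0_norm ?ppow_ge0.
have i2 : mu.-integrable setT (EFin \o (fun x => D * exponential_pdf 2^-1 x)).
  rewrite (_ : _ \o _ = (fun x => D%:E * (exponential_pdf 2^-1 x)%:E)%E)//.
  by apply: integrableZl => //; apply: integrable_exponential_pdf; rewrite invr_gt0.
apply: (le_integrable measurableT _ _ (integrableD measurableT i1 i2)).
  apply/measurable_EFinP; exact: measurable_gexp.
move=> x _ /=.
have r0 : 0 <= (ppow (a - 1) \_ `]0, 1]) x + D * exponential_pdf 2^-1 x.
  rewrite addr_ge0//; first by rewrite patchE; case: ifP => // _; exact: ppow_ge0.
  by rewrite mulr_ge0// exponential_pdf_ge0// invr_ge0.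
rewrite lee_fin ger0_norm// ger0_norm//.
have [x0|x0] := ltP 0 x; first exact: gexp_le.
by rewrite /gexp ppow_le0// mul0r.
Qed.

Let integral_gexp a : 0 < a -> (\int[mu]_x (gexp a x)%:E = (Gamma a)%:E)%E.
Proof.
move=> a0; rewrite GammaEpatch /Rintegral fineK//.
exact/integrable_fin_num/integrable_gexp.
Qed.

(** On [[M, M + 1]] the integrand is at least the left-hand side, since x^(a-1) = x^a / x. As [M] is
    free, Gamma is seen to outgrow every geometric sequence; this stands in for Stirling's
    formula. *)
Lemma Gamma_ge a M : 0 < a -> 1 <= M ->
  M `^ a / (M + 1) * expR (- (M + 1)) <= Gamma a.
Proof.
move=> a0 M1; rewrite -lee_fin -integral_gexp//; set C := _ * _.
have C0 : 0 <= C by rewrite mulr_ge0 ?expR_ge0// divr_ge0 ?powR_ge0//; lra.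
apply: (@le_trans _ _ (\int[mu]_(x in `[M, (M + 1)%R]) C%:E)%E).
  rewrite integral_cst//= lebesgue_measure_itv/= lte_fin ifT; last by lra.
  by rewrite -EFinB -EFinM lee_fin addrAC subrr add0r mulr1.
apply: (@le_trans _ _ (\int[mu]_(x in `[M, (M + 1)%R]) (gexp a x)%:E)%E).
  apply: ge0_le_integral => //.
  - by apply: measurable_funTS; apply/measurable_EFinP; exact: measurable_gexp.
  - move=> x /=; rewrite in_itv/= => /andP[Mx xM]; rewrite lee_fin.
    have x0 : 0 < x by lra.
    apply: ler_pM; rewrite ?expR_ge0 ?divr_ge0 ?powR_ge0//; first by lra.
      rewrite ppow_gt0E// powRB ?(gt_eqF x0) ?implybT// powRr1 ?(ltW x0)//.
      apply: ler_pM; rewrite ?powR_ge0 ?invr_ge0//; first by lra.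
        by apply: ge0_ler_powR; rewrite ?nnegrE ?(ltW a0)//; lra.
      by rewrite lef_pV2 ?posrE//; lra.
    by rewrite ler_expR lerN2.
apply: ge0_subset_integral => //; last by move=> x _; rewrite lee_fin.
apply/measurable_EFinP; exact: measurable_gexp.
Qed.

Lemma Gamma_gt0 a : 0 < a -> 0 < Gamma a.
Proof.
move=> a0; apply: lt_le_trans (Gamma_ge a0 (lexx 1)).
by rewrite mulr_gt0 ?expR_gt0// divr_gt0// powR_gt0.
Qed.

(* Both sides are compared after multiplying by [expR (- t)] and integrating in
   [t]: scaling shows that the left-hand side is a multiple of [t `^ (a + c - 1)],
   and Tonelli's theorem identifies the factor. *)
Lemma integral_beta a c t : 0 < a -> 0 < c -> 0 < t ->
  (\int[mu]_y (ppow (a - 1) (t - y) * ppow (c - 1) y)%:E =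
   (Gamma a * Gamma c / Gamma (a + c) * t `^ (a + c - 1))%:E)%E.
Proof.
move=> a0 c0.
pose B s : \bar R := (\int[mu]_y (ppow (a - 1) (s - y) * ppow (c - 1) y)%:E)%E.
have mB s : measurable_fun setT
    (fun y : R => (ppow (a - 1) (s - y) * ppow (c - 1) y)%:E).
  apply/measurable_EFinP/measurable_funM; last exact: measurable_ppow.
  by apply: (measurableT_comp (measurable_ppow _)); exact: measurable_funB.
have B_ge0 s y : (0 <= (ppow (a - 1) (s - y) * ppow (c - 1) y)%:E)%E.
  by rewrite lee_fin mulr_ge0 ?ppow_ge0.
have BE s : 0 < s -> (B s = (s `^ (a + c - 1))%:E * B 1%R)%E.
  move=> s0; rewrite {1}/B (ge0_integral_affine 0 s0 (mB s) (B_ge0 s)).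
  have E y : ((ppow (a - 1) (s - (0 + s * y)) * ppow (c - 1) (0 + s * y))%:E =
     (s `^ (a - 1) * s `^ (c - 1))%:E *
     (ppow (a - 1) (1 - y) * ppow (c - 1) y)%:E)%E.
    rewrite -EFinM add0r (_ : s - s * y = s * (1 - y)); last by ring.
    by rewrite !ppowM//; congr (_%:E); ring.
  under eq_integral do rewrite E.
  rewrite ge0_integralZl_EFin//; [|exact: (mB 1%R)|by rewrite mulr_ge0 ?powR_ge0].
  rewrite muleA -EFinM; congr (_%:E * _)%E.
  rewrite -{1}(powRr1 (ltW s0)) -!powRD ?(gt_eqF s0) ?implybT//.
  by congr (_ `^ _); ring.
have B1 : (B 1%R * (Gamma (a + c))%:E = (Gamma a * Gamma c)%:E)%E.
  have mg z : measurable_fun setT (fun x => (gexp z x)%:E).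
    apply/measurable_EFinP; exact: measurable_gexp.
  have g0 z x : (0 <= (gexp z x)%:E)%E by rewrite lee_fin.
  have B1_ge0 : (0 <= B 1%R)%E by apply: integral_ge0.
  transitivity ((\int[mu]_x (gexp a x)%:E) * (\int[mu]_x (gexp c x)%:E))%E; last first.
    by rewrite (integral_gexp a0) (integral_gexp c0).
  rewrite -(ge0_integral_conv (mg a) (mg c) (g0 a) (g0 c)).
  rewrite -(integral_gexp (addr_gt0 a0 c0)).
  have <- : (\int[mu]_x (B 1%R * (gexp (a + c) x)%:E) =
      B 1%R * \int[mu]_x (gexp (a + c) x)%:E)%E.
    apply: ge0_integralZl => //; exact: mg.
  apply: eq_integral => s _.
  have E y : ((gexp a (s - y))%:E * (gexp c y)%:E =
      (expR (- s))%:E * (ppow (a - 1) (s - y) * ppow (c - 1) y)%:E)%E.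
    rewrite -!EFinM /gexp (_ : - s = - (s - y) + - y); last by ring.
    by rewrite expRD; congr (_%:E); ring.
  under [RHS]eq_integral do rewrite E.
  rewrite ge0_integralZl_EFin ?expR_ge0//; last exact: mB.
  rewrite -/(B s).
  have [s0|s0] := ltP 0 s.
    by rewrite (BE s s0) /gexp ppow_gt0E// [RHS]muleA -EFinM [RHS]muleC [expR _ * _]mulrC.
  rewrite /gexp ppow_le0// mul0r mule0 [X in (_ * X)%E](_ : _ = 0%E) ?mule0//.
  rewrite /B; apply: integral0_eq => y _.
  have [y0|y0] := ltP 0 y; last by rewrite (ppow_le0 _ y0) mulr0.
  by rewrite ppow_le0 ?mul0r// lerBlDr; lra.
move=> t0; rewrite -/(B t) (BE t t0).
have G0 := Gamma_gt0 (addr_gt0 a0 c0).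
have -> : (B 1%R = (Gamma a * Gamma c / Gamma (a + c))%:E)%E.
  rewrite EFinM -B1 -muleA -EFinM divff ?gt_eqF// mule1//.
by rewrite -EFinM mulrC.
Qed.

(** For [x < b] one has 1 <= exp(b - x), so the truncated power is at most exp(b) times Euler's
    integrand. *)
Lemma integrable_ppow a b : 0 < a ->
  mu.-integrable setT (EFin \o (fun x => if x < b then ppow (a - 1) x else 0)).
Proof.
move=> a0.
have i := integrableZl measurableT (expR b) (integrable_gexp a0).
apply: (le_integrable measurableT _ _ i).
  apply/measurable_EFinP; apply: measurable_fun_ifT => //.
    exact: measurable_fun_ltr.
  exact: measurable_ppow.
move=> x _ /=; rewrite lee_fin; case: ifP => xb; last by rewrite normr0.
rewrite ger0_norm ?ppow_ge0// ger0_norm ?mulr_ge0 ?expR_ge0 ?ppow_ge0//.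
rewrite mulrCA ler_peMr ?ppow_ge0// -expRD -expR0 ler_expR.
by rewrite subr_ge0 ltW.
Qed.

End gamma.

(** * Series estimates *)

Section sums.
Context {R : realType}.
Implicit Types (D : nat -> nat -> R) (C r : R) (N : nat).

Lemma sum_triangle D N :
  \sum_(0 <= n < N) \sum_(0 <= j < n.+1) D j (n - j)%N =
  \sum_(0 <= i < N) \sum_(0 <= j < N - i) D i j.
Proof.
elim: N => [|N IH]; first by rewrite !big_geq.
rewrite big_nat_recr//= IH.
under [RHS]eq_big_nat => i /andP[_ iN].
  rewrite subSn// big_nat_recr//=.
  over.
rewrite big_split/=; congr (_ + _).
by rewrite [RHS]big_nat_recr//= subnn [X in _ = _ + X]big_geq// addr0.
Qed.

(** The square minus the triangle consists of pairs with i + j >= N. There are at most N^2 of them,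
    each contributing at most C r^N. *)
Lemma square_sub_triangle_le D C r N : 0 <= r <= 1 ->
  (forall i j, `|D i j| <= C * r ^+ (i + j)) ->
  `|\sum_(0 <= i < N) \sum_(0 <= j < N) D i j -
    \sum_(0 <= n < N) \sum_(0 <= j < n.+1) D j (n - j)%N|
  <= N%:R * N%:R * (C * r ^+ N).
Proof.
move=> /andP[r0 r1] DC; rewrite sum_triangle -sumrB.
have C0 : 0 <= C.
  by have := DC 0%N 0%N; rewrite expr0 mulr1; exact: le_trans.
apply: le_trans (ler_norm_sum _ _ _) _.
rewrite -mulrA mulr_natl -[X in _ *+ X]subn0 -sumr_const_nat.
apply: ler_sum_nat => i /andP[_ iN].
rewrite (@big_cat_nat _ _ _ (N - i)%N)/= ?leq_subr// addrAC subrr add0r.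
apply: le_trans (ler_norm_sum _ _ _) _.
apply: (@le_trans _ _ (\sum_(N - i <= j < N) C * r ^+ N)).
  apply: ler_sum_nat => j /andP[Nij jN].
  apply: le_trans (DC i j) _; rewrite ler_wpM2l//.
  by apply: ler_wiXn2l => //; rewrite -leq_subLR.
rewrite sumr_const_nat -[leLHS]mulr_natl ler_wpM2r ?mulr_ge0 ?exprn_ge0//.
by rewrite ler_nat leq_subr.
Qed.

(** Squares arise from the product of two partial sums, triangles from the Cauchy product. The ratio
    1/8 gives N^2 8^(-N) <= 2^(-N), by N <= 2^N. *)
Lemma cvg_square_triangle D C (l : R) :
  (forall i j, `|D i j| <= C * 8^-1 ^+ (i + j)) ->
  \sum_(0 <= n < N) \sum_(0 <= j < n.+1) D j (n - j)%N @[N --> \oo] --> l ->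
  \sum_(0 <= i < N) \sum_(0 <= j < N) D i j @[N --> \oo] --> l.
Proof.
move=> DC cl.
have C0 : 0 <= C.
  by have := DC 0%N 0%N; rewrite expr0 mulr1; exact: le_trans.
suff c0 : (\sum_(0 <= i < N) \sum_(0 <= j < N) D i j -
    \sum_(0 <= n < N) \sum_(0 <= j < n.+1) D j (n - j)%N) @[N --> \oo] --> (0 : R).
  have -> : (fun N => \sum_(0 <= i < N) \sum_(0 <= j < N) D i j) =
      (fun N => \sum_(0 <= i < N) \sum_(0 <= j < N) D i j -
        \sum_(0 <= n < N) \sum_(0 <= j < n.+1) D j (n - j)%N +
        \sum_(0 <= n < N) \sum_(0 <= j < n.+1) D j (n - j)%N).
    by apply/funext => N; rewrite subrK.
  by rewrite -(add0r l); exact: cvgD.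
apply/norm_cvg0P.
have g0 : C * 2^-1 ^+ N @[N --> \oo] --> (0 : R).
  have := @cvg_geometric R C 2^-1; apply.
  by rewrite ger0_norm ?invr_ge0// invf_lt1// ltr1n.
apply: squeeze_cvgr (cvg_cst (0 : R)) g0; near=> N; rewrite normr_ge0/=.
have r8 : 0 <= (8^-1 : R) <= 1 by apply/andP; split; lra.
apply: le_trans (@square_sub_triangle_le D C 8^-1 N r8 DC) _.
rewrite mulrCA ler_wpM2l//.
have N2 : N%:R <= 2 ^+ N :> R by rewrite -natrX ler_nat ltnW// ltn_expl.
have -> : 2^-1 ^+ N = 2 ^+ N * 2 ^+ N * 8^-1 ^+ N :> R.
  by rewrite -!exprMn; congr (_ ^+ _); field.
rewrite ler_wpM2r ?exprn_ge0 ?invr_ge0//.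
by apply: ler_pM.
Unshelve. all: by end_near. Qed.

End sums.

(** * Binomial series coefficients and the growth of Gamma *)

Section coefficients.
Context {R : realType}.
Implicit Types (c w : R) (n : nat).

(** The coefficients in x of the binomial series (1 - w x)^(-c), whose Cauchy products add the
    exponents. *)
Definition pcoef w c n : R := pochhammer c n / n`!%:R * w ^+ n.

Lemma pcoef0 w c : pcoef w c 0 = 1.
Proof. by rewrite /pcoef /pochhammer big_ord0 fact0 expr0 divr1 mulr1. Qed.

Lemma pcoefS w c n : n.+1%:R * pcoef w c n.+1 = (c + n%:R) * w * pcoef w c n.
Proof.
rewrite /pcoef /pochhammer big_ord_recr/= factS natrM exprS.
have : n.+1%:R != 0 :> R by rewrite pnatr_eq0.
have : n`!%:R != 0 :> R by rewrite pnatr_eq0 -lt0n fact_gt0.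
move=> h1 h2; rewrite invfM.
move: (n.+1%:R : R) h2 (n`!%:R : R) h1 => x x0 y y0.
by field; rewrite ?x0 ?y0.
Qed.

(* Chu-Vandermonde, by comparing the recursions of both sides. *)
Lemma pcoef_vandermonde w c c' n :
  \sum_(0 <= j < n.+1) pcoef w c j * pcoef w c' (n - j) = pcoef w (c + c') n.
Proof.
elim: n => [|n IH]; first by rewrite big_nat1 !pcoef0 mulr1.
have n0 : n.+1%:R != 0 :> R by rewrite pnatr_eq0.
apply: (mulfI n0); rewrite pcoefS -IH.
have -> : n.+1%:R * (\sum_(0 <= j < n.+2) pcoef w c j * pcoef w c' (n.+1 - j)) =
    \sum_(0 <= j < n.+2) (j%:R * pcoef w c j) * pcoef w c' (n.+1 - j) +
    \sum_(0 <= j < n.+2)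
      pcoef w c j * ((n.+1 - j)%:R * pcoef w c' (n.+1 - j)).
  rewrite mulr_sumr -big_split/=; apply: eq_big_nat => j /andP[_ jn].
  have -> : n.+1%:R = j%:R + (n.+1 - j)%:R :> R by rewrite -natrD subnKC.
  by ring.
rewrite big_nat_recl//= mul0r mul0r add0r.
rewrite [X in _ + X]big_nat_recr//= subnn mul0r mulr0 addr0.
rewrite -big_split/= mulr_sumr; apply: eq_big_nat => j /andP[_ jn].
rewrite subSS subSn// !pcoefS natrB//; ring.
Qed.

(** The ratio of consecutive coefficients, (c + n) w / (n + 1), has modulus at most (1 + |c|)
    |w|. *)
Lemma pcoef_le w c n : `|pcoef w c n| <= ((1 + `|c|) * `|w|) ^+ n.
Proof.
elim: n => [|n IH]; first by rewrite pcoef0 expr0 normr1.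
have n0 : 0 < n.+1%:R :> R by rewrite ltr0n.
rewrite exprS -(ler_pM2l n0) -{1}(gtr0_norm n0) -normrM pcoefS normrM.
rewrite mulrA; apply: ler_pM => //.
rewrite normrM mulrA ler_wpM2r//.
apply: le_trans (ler_normD _ _) _; rewrite normr_nat -natr1.
by have := normr_ge0 c; have : 0 <= n%:R :> R by []; nra.
Qed.

(** In [Gamma_ge], [M] is taken with M^rho >= b^rho / L. Then Gamma(rho n + beta) is at least E
    (M^rho)^n, which exceeds (b^rho)^n by the factor E / L^n. *)
Lemma Gamma_growth (rho beta b L : R) : 0 < rho -> 0 < beta -> 0 < b -> 0 < L ->
  exists2 C, 0 <= C & forall n x, 0 <= x <= b ->
    (x `^ rho) ^+ n / Gamma (rho * n%:R + beta) <= C * L ^+ n.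
Proof.
move=> rho0 beta0 b0 L0.
pose B := b `^ rho / L.
have B0 : 0 < B by rewrite divr_gt0// powR_gt0.
pose M := Num.max 1 (B `^ rho^-1).
have M1 : 1 <= M by rewrite le_max lexx.
have M0 : 0 < M by exact: lt_le_trans M1.
have BM : B <= M `^ rho.
  rewrite -[leLHS](powRr1 (ltW B0)) -(mulVf (lt0r_neq0 rho0)) powRrM.
  apply: ge0_ler_powR; rewrite ?nnegrE ?powR_ge0 ?(ltW rho0) ?(ltW M0)//.
  by rewrite le_max lexx orbT.
pose E := M `^ beta / (M + 1) * expR (- (M + 1)).
have E0 : 0 < E by rewrite mulr_gt0 ?expR_gt0// divr_gt0 ?powR_gt0//; lra.
exists E^-1 => [|n x /andP[x0 xb]]; first by rewrite invr_ge0 ltW.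
have arg0 : 0 < rho * n%:R + beta by rewrite ltr_wpDl// mulr_ge0// ltW.
rewrite ler_pdivrMr ?Gamma_gt0// -mulrA ler_pdivlMl//.
apply: (@le_trans _ _ (E * (L * M `^ rho) ^+ n)).
  rewrite ler_wpM2l ?(ltW E0)//; apply: lerXn2r; rewrite ?nnegrE ?powR_ge0//.
    by rewrite mulr_ge0 ?powR_ge0// ltW.
  apply: (@le_trans _ _ (b `^ rho)).
    by apply: ge0_ler_powR; rewrite ?nnegrE ?(ltW rho0)// ltW.
  by rewrite -ler_pdivrMl// mulrC.
rewrite exprMn mulrCA ler_wpM2l ?exprn_ge0 ?(ltW L0)//.
apply: le_trans (Gamma_ge arg0 M1).
rewrite /E powRD ?(gt_eqF M0) ?implybT// powRrM powR_mulrn ?powR_ge0//.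
by rewrite le_eqVlt; apply/orP; left; apply/eqP; ring.
Qed.

End coefficients.

(** * The Prabhakar kernel *)

Section kernel.
Context {R : realType}.
Local Notation mu := (@lebesgue_measure R).
Local Notation T := (measurableTypeR R).
Variables (rho omega : R).
Hypothesis rho0 : 0 < rho.
Implicit Types (beta gam b x t : R) (n N : nat).

Let arg_gt0 beta n : 0 < beta -> 0 < rho * n%:R + beta.
Proof. by move=> h; rewrite ltr_wpDl// mulr_ge0// ltW. Qed.

Let pterm beta gam x n : R :=
  pochhammer gam n / Gamma (rho * n%:R + beta) *
  ((omega * x `^ rho) ^+ n / n`!%:R).

Let ptermE beta gam x n : pterm beta gam x n =
  pcoef omega gam n * ((x `^ rho) ^+ n / Gamma (rho * n%:R + beta)).
Proof. by rewrite /pterm /pcoef exprMn; ring. Qed.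

(** [A] dominates the growth of both coefficient sequences, and its summand 1 keeps it positive when
    [omega = 0]. Applying [Gamma_growth] with ratio 1 / (8A) cancels A^(i+j) and leaves 1/8. The
    case [j = 0] bounds a single series. *)
Let coef_bound gam gam' beta b : 0 < beta -> 0 < b -> exists2 C, 0 <= C &
  forall i j x, 0 <= x <= b ->
  `|pcoef omega gam i * pcoef omega gam' j *
    ((x `^ rho) ^+ (i + j) / Gamma (rho * (i + j)%:R + beta))|
  <= C * 8^-1 ^+ (i + j).
Proof.
move=> beta0 b0; pose A := (1 + `|gam| + `|gam'|) * `|omega| + 1.
have A0 : 0 < A by rewrite ltr_wpDl// mulr_ge0// !addr_ge0.
have L0 : 0 < (8 * A)^-1 by rewrite invr_gt0 mulr_gt0.
have [C C0 H] := Gamma_growth rho0 beta0 b0 L0.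
exists C => // i j x xb.
have q0 : 0 <= (x `^ rho) ^+ (i + j) / Gamma (rho * (i + j)%:R + beta).
  by rewrite divr_ge0 ?exprn_ge0 ?powR_ge0// ltW// Gamma_gt0// arg_gt0.
have P c n : `|c| <= `|gam| + `|gam'| -> `|pcoef omega c n| <= A ^+ n.
  move=> ch; apply: le_trans (pcoef_le _ _ _) _.
  apply: lerXn2r; rewrite ?nnegrE ?(ltW A0) ?mulr_ge0 ?addr_ge0//.
  apply: (@le_trans _ _ ((1 + `|gam| + `|gam'|) * `|omega|)); last by rewrite lerDl.
  by rewrite ler_wpM2r// -addrA lerD2l.
rewrite 2!normrM (ger0_norm q0).
apply: (@le_trans _ _ (A ^+ i * A ^+ j * (C * (8 * A)^-1 ^+ (i + j)))).
  apply: ler_pM => //; last exact: H.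
  by apply: ler_pM => //; apply: P; rewrite ?lerDl ?lerDr.
rewrite -exprD mulrCA -exprMn invfM mulrCA divff ?mulr1//.
by rewrite gt_eqF.
Qed.

Lemma prabhakar_series beta gam b : 0 < beta -> 0 < b -> exists2 C, 0 <= C &
  forall x, 0 <= x <= b ->
  (forall N, `|\sum_(0 <= n < N) pterm beta gam x n| <= C) /\
  \sum_(0 <= n < N) pterm beta gam x n @[N --> \oo] -->
    prabhakar rho beta gam (omega * x `^ rho).
Proof.
move=> beta0 b0; have [C C0 H] := coef_bound gam 0 beta0 b0.
have r1 : `|8^-1| < 1 :> R by rewrite ger0_norm ?invr_ge0// invf_lt1// ltr1n.
have tle x n : 0 <= x <= b -> `|pterm beta gam x n| <= C * 8^-1 ^+ n.
  by move=> /(H n 0%N); rewrite pcoef0 mulr1 addn0 -ptermE.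
exists (C / (1 - 8^-1)) => [|x xb].
  by rewrite divr_ge0// subr_ge0 invf_le1// ler1n.
split=> [N|].
  apply: le_trans (ler_norm_sum _ _ _) _.
  apply: (@le_trans _ _ (\sum_(0 <= n < N) C * 8^-1 ^+ n)).
    by apply: ler_sum => n _; exact: tle.
  have := @geometric_le_lim R N C 8^-1 C0; rewrite invr_gt0 => /(_ _ r1); apply.
  by [].
have cv : cvgn (series (pterm beta gam x)).
  apply: normed_cvg; apply: (@series_le_cvg _ _ (geometric C 8^-1)).
  - by move=> n /=.
  - by move=> n; rewrite /geometric/= mulr_ge0// exprn_ge0// invr_ge0.
  - by move=> n; exact: tle.
  - exact: is_cvg_geometric_series.
exact: cv.
Qed.

Definition kernel beta gam x : R :=
  ppow (beta - 1) x * prabhakar rho beta gam (omega * x `^ rho).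

(** Partial sums of the kernel, expanded into powers so that Euler's Beta integral applies term by
    term. *)
Let kernelN beta gam N x : R :=
  \sum_(0 <= n < N) pcoef omega gam n / Gamma (rho * n%:R + beta) *
    ppow (rho * n%:R + beta - 1) x.

Let kernelNE beta gam N x : kernelN beta gam N x =
  ppow (beta - 1) x * \sum_(0 <= n < N) pterm beta gam x n.
Proof.
rewrite /kernelN mulr_sumr; apply: eq_bigr => n _.
have [x0|x0] := ltP 0 x; last by rewrite !ppow_le0// mulr0 mul0r.
rewrite ptermE !ppow_gt0E// -addrA [in LHS]powRD ?(gt_eqF x0) ?implybT//.
by rewrite powRrM powR_mulrn ?powR_ge0//; ring.
Qed.

Let kernelN_cvg beta gam x : 0 < beta ->
  kernelN beta gam N x @[N --> \oo] --> kernel beta gam x.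
Proof.
move=> beta0; have [x0|x0] := ltP 0 x; last first.
  rewrite (_ : (fun N => kernelN beta gam N x) = fun=> kernel beta gam x).
    exact: cvg_cst.
  by apply/funext => N; rewrite kernelNE /kernel ppow_le0// !mul0r.
under eq_cvg do rewrite kernelNE.
have [C _ H] := prabhakar_series gam beta0 x0.
apply: cvgM; first exact: cvg_cst.
by have [|_] := H x; rewrite ?lexx ?(ltW x0).
Qed.

Let measurable_kernelN beta gam N : measurable_fun setT (kernelN beta gam N).
Proof.
apply: measurable_sum => n; apply: measurable_funM => //.
exact: measurable_ppow.
Qed.

Lemma measurable_kernel beta gam : 0 < beta ->
  measurable_fun setT (kernel beta gam).
Proof.
move=> beta0; apply: (measurable_fun_cvg (measurable_kernelN beta gam)).
by move=> x _; exact: kernelN_cvg.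
Qed.

Let kernelN_le beta gam b : 0 < beta -> 0 < b -> exists2 C, 0 <= C &
  forall N x, x <= b -> `|kernelN beta gam N x| <= C * ppow (beta - 1) x.
Proof.
move=> beta0 b0; have [C C0 H] := prabhakar_series gam beta0 b0.
exists C => // N x xb; rewrite kernelNE.
have [x0|x0] := ltP 0 x; last by rewrite ppow_le0// mul0r mulr0 normr0.
rewrite normrM (ger0_norm (ppow_ge0 _ _)) mulrC ler_wpM2r ?ppow_ge0//.
by have [|+ _] := H x; rewrite ?xb ?(ltW x0).
Qed.

Lemma integrable_kernel beta gam b : 0 < beta -> 0 < b ->
  mu.-integrable setT (EFin \o (fun x => if x < b then kernel beta gam x else 0)).
Proof.
move=> beta0 b0; have [C C0 H] := kernelN_le gam beta0 b0.
have i := integrableZl measurableT C (integrable_ppow b beta0).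
apply: (le_integrable measurableT _ _ i).
  apply/measurable_EFinP; apply: measurable_fun_ifT => //.
    exact: measurable_fun_ltr.
  exact: measurable_kernel.
move=> x _ /=; rewrite lee_fin; case: ifP => xb; last by rewrite normr0.
rewrite (ger0_norm (mulr_ge0 C0 (ppow_ge0 _ _))).
have cv := cvg_norm (@kernelN_cvg beta gam x beta0).
have <- : limn (fun N => `|kernelN beta gam N x|) = `|kernel beta gam x|.
  by apply/cvg_lim => //; exact: cv.
apply: limr_le; first by apply/cvg_ex; eexists; exact: cv.
by near=> N; apply: H; exact: ltW.
Unshelve. all: by end_near. Qed.

(** * Semigroup law of the kernels *)

Section semigroup.
Variables (beta beta' gam gam' t : R).
Hypotheses (beta0 : 0 < beta) (beta'0 : 0 < beta') (t0 : 0 < t).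

Let pp (i j : nat) (y : R) : R := ppow (rho * i%:R + beta - 1) (t - y) *
  ppow (rho * j%:R + beta' - 1) y.

Let pp_ge0 i j y : 0 <= pp i j y.
Proof. by rewrite mulr_ge0 ?ppow_ge0. Qed.

Let measurable_pp i j : measurable_fun setT (pp i j).
Proof.
apply: measurable_funM; last exact: measurable_ppow.
by apply: (measurableT_comp (measurable_ppow _)); exact: measurable_funB.
Qed.

Let integral_pp i j : (\int[mu]_y (pp i j y)%:E =
  (Gamma (rho * i%:R + beta) * Gamma (rho * j%:R + beta') /
   Gamma (rho * (i + j)%:R + (beta + beta')) *
   (t `^ (beta + beta' - 1) * (t `^ rho) ^+ (i + j)))%:E)%E.
Proof.
rewrite integral_beta ?arg_gt0//; congr (_ %:E).
have -> : rho * i%:R + beta + (rho * j%:R + beta') =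
  rho * (i + j)%:R + (beta + beta') by rewrite natrD; ring.
congr (_ * _); rewrite -addrA [in LHS]powRD ?(gt_eqF t0) ?implybT//.
by rewrite powRrM powR_mulrn ?powR_ge0// mulrC.
Qed.

Let integrable_pp i j : mu.-integrable setT (EFin \o pp i j).
Proof.
apply/integrableP; split; first by apply/measurable_EFinP; exact: measurable_pp.
under eq_integral do rewrite /= ger0_norm//.
by rewrite integral_pp ltry.
Qed.

Let D i j : R := pcoef omega gam i * pcoef omega gam' j *
  ((t `^ rho) ^+ (i + j) / Gamma (rho * (i + j)%:R + (beta + beta'))).

Let F N (y : R) : R := kernelN beta gam N (t - y) * kernelN beta' gam' N y.

Let integral_F N : (\int[mu]_y (F N y)%:E =
  (t `^ (beta + beta' - 1) *
   \sum_(0 <= i < N) \sum_(0 <= j < N) D i j)%:E)%E.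
Proof.
pose c i j := (pcoef omega gam i / Gamma (rho * i%:R + beta)) *
  (pcoef omega gam' j / Gamma (rho * j%:R + beta')).
have FE y : (F N y)%:E =
    (\sum_(0 <= i < N) \sum_(0 <= j < N) (c i j)%:E * (pp i j y)%:E)%E.
  rewrite /F /kernelN mulr_suml -sumEFin; apply: eq_bigr => i _.
  rewrite mulr_sumr -sumEFin; apply: eq_bigr => j _.
  by rewrite -EFinM; congr (_ %:E); rewrite /c /pp; ring.
have ic i j : mu.-integrable setT (fun y => (c i j)%:E * (pp i j y)%:E)%E.
  by apply: (integrableZl measurableT (c i j) (integrable_pp i j)).
under eq_integral do rewrite FE.
rewrite integral_sum//=; last by move=> i; apply: integrable_sum.
rewrite mulr_sumr -sumEFin; apply: eq_bigr => i _.
rewrite integral_sum//=.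
rewrite mulr_sumr -sumEFin; apply: eq_bigr => j _.
rewrite integralZl//; last exact: integrable_pp.
rewrite integral_pp -EFinM /c /D; congr (_ %:E).
have Gi := Gamma_gt0 (arg_gt0 i beta0); have Gj := Gamma_gt0 (arg_gt0 j beta'0).
have Gij := Gamma_gt0 (arg_gt0 (i + j) (addr_gt0 beta0 beta'0)).
move: (Gamma _) Gi (Gamma _) Gj (Gamma _) Gij => u u0 v v0 w w0.
by field; rewrite !gt_eqF.
Qed.

(** In the termwise integrals the Beta factors cancel the two Gamma denominators and leave one that
    depends on i + j only, so each diagonal is a Chu-Vandermonde sum. Dominated convergence, with a
    multiple of [pp 0 0] as majorant, passes from the partial sums to the kernels. *)
Lemma conv_kernel : conv (kernel beta gam) (kernel beta' gam') t =
  kernel (beta + beta') (gam + gam') t.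
Proof.
have bb0 : 0 < beta + beta' by exact: addr_gt0.
have tt : 0 <= t <= t by rewrite lexx ltW.
have [C C0 DC] := coef_bound gam gam' bb0 t0.
have [B B0 HB] := kernelN_le gam beta0 t0.
have [B' B'0 HB'] := kernelN_le gam' beta'0 t0.
have lim1 : \sum_(0 <= i < N) \sum_(0 <= j < N) D i j @[N --> \oo] -->
    prabhakar rho (beta + beta') (gam + gam') (omega * t `^ rho).
  apply: (@cvg_square_triangle _ D C) => [i j|]; first exact: DC.
  have [E _ H] := prabhakar_series (gam + gam') bb0 t0.
  have [_] := H t tt.
  apply: cvg_trans; apply: near_eq_cvg; near=> N.
  apply: eq_big_nat => n _; rewrite ptermE -pcoef_vandermonde mulr_suml.
  by apply: eq_big_nat => j /andP[_ jn]; rewrite /D subnKC.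
have measF N : measurable_fun setT (fun y => (F N y)%:E).
  apply/measurable_EFinP/measurable_funM; last exact: measurable_kernelN.
  by apply: (measurableT_comp (measurable_kernelN _ _ _)); exact: measurable_funB.
pose f (y : R) : R := kernel beta gam (t - y) * kernel beta' gam' y.
have measf : measurable_fun setT (fun y => (f y)%:E).
  apply/measurable_EFinP/measurable_funM; last exact: measurable_kernel.
  by apply: (measurableT_comp (measurable_kernel _ beta0)); exact: measurable_funB.
have Ff y : (F N y)%:E @[N --> \oo] --> (f y)%:E.
  by apply: cvg_EFin; [exact: nearW|apply: cvgM; exact: kernelN_cvg].
have ig := integrableZl measurableT (B * B') (integrable_pp 0 0).
have Fle N y : (`|(F N y)%:E| <= (B * B')%:E * (pp 0 0 y)%:E)%E.
  rewrite -EFinM lee_fin /F /pp !mulr0 !add0r normrM mulrACA.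
  have [y0|y0] := ltP 0 y; last first.
    by rewrite !kernelNE !(ppow_le0 _ y0) mul0r normr0 !mulr0.
  have [ty|ty] := ltP 0 (t - y); last first.
    by rewrite !kernelNE !(ppow_le0 _ ty) mul0r normr0 mul0r mulr0 mul0r.
  by apply: ler_pM => //; [apply: HB|apply: HB']; lra.
have [||_ _ lim2] := @dominated_convergence _ _ _ mu setT measurableT
  (fun N y => (F N y)%:E) (fun y => (f y)%:E) _ measF measf _ ig.
- by apply: aeW => y _; exact: Ff.
- by apply: aeW => y N _; exact: Fle.
have lim3 : (\int[mu]_y (F N y)%:E)%E @[N --> \oo] -->
    (kernel (beta + beta') (gam + gam') t)%:E.
  under eq_cvg do rewrite integral_F.
  apply: cvg_EFin; first exact: nearW.
  rewrite /kernel ppow_gt0E//.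
  by apply: cvgM => //; exact: cvg_cst.
rewrite /conv /Rintegral.
have -> : (\int[mu]_y (f y)%:E = (kernel (beta + beta') (gam + gam') t)%:E)%E.
  exact: (cvg_unique _ lim2 lim3).
by [].
Unshelve. all: by end_near. Qed.

End semigroup.

End kernel.

(** * Prabhakar operators as convolutions *)

Section causal.
Context {R : realType}.
Local Notation mu := (@lebesgue_measure R).
Local Notation T := (measurableTypeR R).
Implicit Types (u v w : R -> R) (b c t : R).

Definition causal u : Prop := forall x, x <= 0 -> u x = 0.

Let measurable_sub t : measurable_fun setT (fun y : T => t - y : R).
Proof. exact: measurable_funB. Qed.

Lemma conv_comm u v t : measurable_fun setT u -> measurable_fun setT v ->
  conv u v t = conv v u t.
Proof.
move=> mu_ mv; rewrite /conv /Rintegral; congr fine.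
rewrite -[LHS](@integral_sub _ t); last first.
  apply/measurable_EFinP/measurable_funM => //.
  exact: (measurableT_comp mu_ (measurable_sub t)).
by apply: eq_integral => y _; rewrite subKr mulrC.
Qed.

Lemma conv_causal u v : causal u -> causal v -> causal (conv u v).
Proof.
move=> cu cv x x0; rewrite /conv /Rintegral integral0_eq// => y _.
have [y0|y0] := leP y 0; first by rewrite cv// mulr0.
by rewrite cu ?mul0r//; lra.
Qed.

(** Causality of [v] restricts the integral to [y > 0], where the argument [t - y] of [u] stays
    below [b]. *)
Lemma eq_convl u u' v b t : t < b -> (forall x, x < b -> u x = u' x) ->
  causal v -> conv u v t = conv u' v t.
Proof.
move=> tb uu' cv; apply: eq_Rintegral => y _.
have [y0|y0] := leP y 0; first by rewrite cv// !mulr0.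
by rewrite uu'//; lra.
Qed.

Lemma eq_convr u v v' b t : t < b -> (forall x, x < b -> v x = v' x) ->
  causal u -> conv u v t = conv u v' t.
Proof.
move=> tb vv' cu; apply: eq_Rintegral => y _.
have [by_|yb] := leP b y; first by rewrite cu ?mul0r//; lra.
by rewrite vv'.
Qed.

Lemma convDr u v w c t :
  mu.-integrable setT (fun y => (u (t - y) * v y)%:E) ->
  mu.-integrable setT (fun y => (u (t - y) * w y)%:E) ->
  conv u (fun y => c * v y + w y) t = c * conv u v t + conv u w t.
Proof.
move=> iv iw; rewrite /conv -RintegralZl// -RintegralD//; last first.
  exact: (integrableZl measurableT c iv).
by apply: eq_Rintegral => y _; ring.
Qed.

Lemma integrable_sub u t : mu.-integrable setT (EFin \o u) ->
  mu.-integrable setT (fun y : R => (u (t - y))%:E).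
Proof.
move=> /integrableP[/measurable_EFinP mu_ fu]; apply/integrableP; split.
  by apply/measurable_EFinP; exact: (measurableT_comp mu_ (measurable_sub t)).
rewrite (@integral_sub _ t (fun x => `|(u x)%:E|%E))//.
by apply/measurable_EFinP; exact: measurableT_comp.
Qed.

Lemma integrable_conv_bounded u v M t : mu.-integrable setT (EFin \o u) ->
  measurable_fun setT v -> (forall x, `|v x| <= M) ->
  mu.-integrable setT (fun y : R => (u (t - y) * v y)%:E).
Proof.
move=> iu mv vM.
have mu_ : measurable_fun setT u by apply/measurable_EFinP; exact: measurable_int iu.
have iM := integrableZl measurableT M (integrable_sub t iu).
apply: (le_integrable measurableT _ _ iM).
  apply/measurable_EFinP/measurable_funM => //.
  exact: (measurableT_comp mu_ (measurable_sub t)).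
move=> y _ /=; rewrite lee_fin !normrM mulrC ler_wpM2r//.
exact: le_trans (vM y) (ler_norm M).
Qed.

(** The cut makes the kernels integrable on the line and every factor causal, and it does not affect
    convolutions of causal functions at points below [b]. *)
Definition truncate b u x : R := if 0 < x < b then u x else 0.

Lemma truncate_id b u x : 0 < x < b -> truncate b u x = u x.
Proof. by rewrite /truncate => ->. Qed.

Lemma causal_truncate b u : causal (truncate b u).
Proof. by move=> x x0; rewrite /truncate ltNge x0. Qed.

Lemma integrable_truncate b u : mu.-integrable setT (EFin \o u) ->
  mu.-integrable setT (EFin \o truncate b u).
Proof.
move=> iu.
have mu_ : measurable_fun setT u by apply/measurable_EFinP; exact: measurable_int iu.
apply: (le_integrable measurableT _ _ iu).
  apply/measurable_EFinP; apply: measurable_fun_ifT => //.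
  by apply: measurable_and; exact: measurable_fun_ltr.
by move=> x _ /=; rewrite lee_fin /truncate; case: ifP; rewrite ?normr0.
Qed.

Local Notation one b := (truncate b (cst (1 : R))).

Lemma integrable_one b : mu.-integrable setT (EFin \o one b).
Proof.
have := @integrable_indic_itv R 0 b false true.
apply: eq_integrable => // x _ /=; rewrite /truncate/= indicE.
by rewrite [in RHS]fun_if; case: ifP => h; rewrite mem_setE in_itv/= h.
Qed.

Lemma one_le1 b x : `|one b x| <= 1.
Proof. by rewrite /truncate; case: ifP; rewrite ?normr1// normr0. Qed.

Let measurable_one b : measurable_fun setT (one b).
Proof. by apply/measurable_EFinP; exact: measurable_int (integrable_one b). Qed.

Lemma ae_neq (a : R) : {ae mu, forall x, x != a}.
Proof.
exists [set a]; split; [exact: measurable_set1|exact: lebesgue_measure_set1|].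
by move=> x /= /negP; rewrite negbK => /eqP.
Qed.

Lemma conv_one b w t : 0 < t < b -> causal w ->
  conv (one b) w t = \int[mu]_(y in `]0, t]) w y.
Proof.
move=> /andP[t0 tb] cw; rewrite Rintegral_mkcond /conv; apply: ae_eq_Rintegral.
(* At [y = t] the step function is evaluated at 0, where it vanishes, although []0, t]] contains
   that point. *)
apply: filterS (ae_neq t); first exact: (ae_filter_ringOfSetsType mu).
move=> y yt _; rewrite patchE.
have [y0|y0] := leP y 0; first by rewrite cw// mulr0; case: ifP.
have [ty|ty] := ltP t y.
  rewrite ifF; last by apply/negP; rewrite inE/= in_itv/= y0/= leNgt ty.
  by rewrite causal_truncate ?mul0r//; lra.
rewrite ifT; last by rewrite inE/= in_itv/= y0.
have yt' : y < t by rewrite lt_neqAle yt.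
by rewrite truncate_id ?mul1r//; lra.
Qed.

Lemma integrable_bounded_conv u v t : measurable_fun setT u ->
  (forall x, `|u x| <= 1) -> mu.-integrable setT (EFin \o v) ->
  mu.-integrable setT (fun y : R => (u (t - y) * v y)%:E).
Proof.
move=> mu_ u1 iv; apply: (le_integrable measurableT _ _ iv).
  apply/measurable_EFinP/measurable_funM.
    exact: (measurableT_comp mu_ (measurable_sub t)).
  by apply/measurable_EFinP; exact: measurable_int iv.
by move=> y _ /=; rewrite lee_fin normrM ler_piMl.
Qed.

(** With a bounded first factor the absolute triple integral is finite at every [t]. The identity
    then holds everywhere, as its later differentiation demands. *)
Lemma conv_assoc_bounded u v w t : measurable_fun setT u ->
  (forall x, `|u x| <= 1) -> mu.-integrable setT (EFin \o v) ->
  mu.-integrable setT (EFin \o w) ->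
  conv u (conv v w) t = conv (conv u v) w t.
Proof.
move=> mu_ u1 /integrableP[/measurable_EFinP mv fv]
  /integrableP[/measurable_EFinP mw fw].
have mabs (z : R -> R) : measurable_fun setT z ->
    measurable_fun setT (fun x => `|z x|%:E).
  by move=> mz; apply/measurable_EFinP; exact: measurableT_comp.
have mG : measurable_fun setT
    (fun y : R => \int[mu]_s (`|v (y - s)|%:E * `|w s|%:E))%E.
  by apply: (@measurable_ge0_conv _ (fun x => `|v x|%:E) (fun x => `|w x|%:E)) => //;
    exact: mabs.
have G0 (y : R) : (0 <= \int[mu]_s (`|v (y - s)|%:E * `|w s|%:E))%E.
  by apply: integral_ge0 => s _; rewrite mule_ge0.
apply: conv_assoc_at => //.
apply: (@le_lt_trans _ _
    (\int[mu]_y \int[mu]_s (`|v (y - s)|%:E * `|w s|%:E))%E).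
  apply: ge0_le_integral => //.
  - by move=> y _; rewrite mule_ge0.
  - apply: emeasurable_funM => //.
    exact: (measurableT_comp (mabs _ mu_) (measurable_sub t)).
  - move=> y _; rewrite -[leRHS]mul1e; apply: lee_wpmul2r => //.
    by rewrite lee_fin.
rewrite (@ge0_integral_conv _ (fun x => `|v x|%:E) (fun x => `|w x|%:E))//;
  [|exact: mabs..].
apply: lte_mul_pinfty; [exact: integral_ge0| |exact: fw].
by apply/fin_numPlt; rewrite (@lt_le_trans _ _ 0%E)//= ?integral_ge0.
Qed.

Lemma conv_bounded u v t : measurable_fun setT u ->
  (forall x, `|u x| <= 1) -> mu.-integrable setT (EFin \o v) ->
  `|conv u v t| <= \int[mu]_y `|v y|.
Proof.
move=> mu_ u1 iv; have i := integrable_bounded_conv t mu_ u1 iv.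
apply: le_trans (le_normr_Rintegral measurableT i) _.
apply: le_Rintegral => //.
- by have := integrable_norm i; apply: eq_integrable.
- by have := integrable_norm iv; apply: eq_integrable.
- by move=> y _; rewrite normrM ler_piMl.
Qed.

(* With [f = c + \int h], this moves the integration of [h] outside the
   convolution: [u * (c + 1 * h) = 1 * (c u + u * h)]. *)
Lemma conv_primitive b c u h t : 0 < t < b -> causal u -> causal h ->
  mu.-integrable setT (EFin \o u) -> mu.-integrable setT (EFin \o h) ->
  conv u (fun y => c * one b y + conv (one b) h y) t =
  \int[mu]_(x in `]0, t]) (c * u x + conv u h x).
Proof.
move=> tb cu ch iu ih.
have mu_ : measurable_fun setT u by apply/measurable_EFinP; exact: measurable_int iu.
have mh : measurable_fun setT h by apply/measurable_EFinP; exact: measurable_int ih.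
have i1h := integrable_conv (integrable_one b) ih.
have m1h : measurable_fun setT (conv (one b) h).
  by apply/measurable_EFinP; exact: measurable_int i1h.
have iuh := integrable_conv iu ih.
have cuh : causal (conv u h) by exact: conv_causal.
rewrite convDr; last 2 first.
- exact: (integrable_conv_bounded t iu (measurable_one b) (one_le1 b)).
- apply: (integrable_conv_bounded t iu m1h) => x.
  exact: (conv_bounded x (measurable_one b) (one_le1 b) ih).
rewrite -(conv_one tb); last by move=> x x0; rewrite cu// cuh// mulr0 addr0.
rewrite convDr; last 2 first.
- exact: (integrable_bounded_conv t (measurable_one b) (one_le1 b) iu).
- exact: (integrable_bounded_conv t (measurable_one b) (one_le1 b) iuh).
rewrite (conv_comm t mu_ (measurable_one b)); congr (_ + _).
rewrite (conv_comm t mu_ m1h).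
rewrite -(conv_assoc_bounded t (measurable_one b) (one_le1 b) ih iu).
by congr (conv _ _ t); apply/funext => x; exact: conv_comm.
Qed.

End causal.

(** * The inner and the outer operator *)

Section prabhakar_operators.
Context {R : realType}.
Local Notation mu := (@lebesgue_measure R).
Variables (rho omega b : R).
Hypotheses (rho0 : 0 < rho) (b0 : 0 < b).
Implicit Types (beta gam t c : R) (f h w : R -> R).

Let K beta gam := truncate b (kernel rho omega beta gam).

Let integrable_K beta gam : 0 < beta -> mu.-integrable setT (EFin \o K beta gam).
Proof.
move=> beta0; have := integrable_kernel omega rho0 gam beta0 b0.
apply: eq_integrable => // x _ /=; rewrite /K /truncate.
have [x0|x0]/= := ltP 0 x; first by [].
by rewrite /kernel ppow_le0// mul0r if_same.
Qed.

Let causal_K beta gam : causal (K beta gam).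
Proof. exact: causal_truncate. Qed.

(** [w] is a causal representative of [f], which may itself be a [derive1] that is known only almost
    everywhere. *)
Lemma prabhakar_int_conv beta gam f w t : 0 < beta -> 0 < t < b -> causal w ->
  {ae mu, forall y, 0 < y < b -> f y = w y} ->
  prabhakar_int rho beta omega gam f t = conv (K beta gam) w t.
Proof.
move=> beta0 /andP[t0 tb] cw fw.
rewrite /prabhakar_int (gt_eqF beta0)/= Rintegral_mkcond; apply: ae_eq_Rintegral.
(* Both endpoints are discarded: at [y = 0] the integrand involves [f 0] while [w] vanishes, and at
   [y = t] the power functions [powR] and [ppow] may differ. *)
apply: (@filterS3 _ _ (ae_filter_ringOfSetsType mu)) fw (ae_neq 0) (ae_neq t).
move=> y fwy yn0 ynt _; rewrite patchE.
have [y0|y0] := leP y 0.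
  rewrite cw// mulr0 ifF//; apply/negP; rewrite inE/= in_itv/= => /andP[y0' _].
  by move: yn0; rewrite eq_le y0 y0'.
have [ty|ty] := ltP t y.
  rewrite ifF; last by apply/negP; rewrite inE/= in_itv/= (ltW y0)/= leNgt ty.
  by rewrite causal_K ?mul0r//; lra.
rewrite ifT; last by rewrite inE/= in_itv/= (ltW y0).
have yt : y < t by rewrite lt_neqAle ynt.
rewrite fwy ?y0 ?(lt_trans yt)// /K truncate_id; last by lra.
by rewrite /kernel ppow_gt0E// subr_gt0.
Qed.

(** The common form c k + k * h: differentiating the inner operator produces it, and the outer
    operator preserves it while adding to the parameters of k. *)
Let G beta gam c h (x : R) := c * K beta gam x + conv (K beta gam) (truncate b h) x.

Lemma ae_derive1_prabhakar_int beta gam f h c : 0 < beta ->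
  mu.-integrable setT (EFin \o h) ->
  (forall x, 0 <= x <= b -> f x = c + \int[mu]_(y in `]0, x]) h y) ->
  {ae mu, forall t, 0 < t < b ->
    derive1 (prabhakar_int rho beta omega gam f) t = G beta gam c h t}.
Proof.
move=> beta0 ih fE.
have iK := integrable_K gam beta0.
have ihb := integrable_truncate b ih.
have iG : mu.-integrable setT (EFin \o G beta gam c h).
  exact: (integrableD measurableT (integrableZl measurableT c iK)
    (integrable_conv iK ihb)).
apply: (ae_derive1_primitive (c := 0) iG) => t tb.
(* A causal function equal to [f] on []0, b[], in the form that [conv_primitive] takes. *)
pose w y := c * truncate b (cst (1 : R)) y + conv (truncate b (cst (1 : R))) (truncate b h) y.
have cw : causal w.
  move=> x x0; rewrite /w causal_truncate// mulr0 add0r.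
  by apply: conv_causal => //; exact: causal_truncate.
rewrite add0r (@prabhakar_int_conv _ _ _ w)//; last first.
  apply: aeW => y yb; rewrite /w truncate_id// mulr1 conv_one//; last first.
    exact: causal_truncate.
  case/andP: yb => y0 yb; rewrite fE ?(ltW y0) ?(ltW yb)//; congr (_ + _).
  apply: eq_Rintegral => x; rewrite inE/= in_itv/= => /andP[x0 xy].
  by rewrite truncate_id// x0 (le_lt_trans xy).
exact: conv_primitive tb (@causal_K _ _) (@causal_truncate _ _ _) iK ihb.
Qed.

Lemma conv_prabhakar_int beta beta' gam gam' f h c : 0 < beta -> 0 < beta' ->
  mu.-integrable setT (EFin \o h) ->
  {ae mu, forall t, 0 < t < b -> f t = G beta gam c h t} ->
  {ae mu, forall t, 0 < t < b ->
    prabhakar_int rho beta' omega gam' f t = G (beta' + beta) (gam' + gam) c h t}.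
Proof.
move=> beta0 beta'0 ih fG.
have iK := integrable_K gam beta0; have iK' := integrable_K gam' beta'0.
have ihb := integrable_truncate b ih.
have cG : causal (G beta gam c h).
  move=> x x0; rewrite /G causal_K// mulr0 add0r.
  by apply: conv_causal => //; exact: causal_truncate.
(* Past [b] the truncation is felt, so the semigroup law passes to truncated kernels only below [b];
   causality of [truncate b h] makes that enough. *)
have KK x : x < b -> conv (K beta' gam') (K beta gam) x =
    K (beta' + beta) (gam' + gam) x.
  move=> xb; have [x0|x0] := ltP 0 x; last by rewrite conv_causal// causal_K.
  rewrite /K (truncate_id _ (_ : 0 < x < b)) ?x0//.
  rewrite -(conv_kernel _ rho0 _ _ beta'0 beta0 x0).
  have ck z z' : causal (kernel rho omega z z').
    by move=> y y0; rewrite /kernel ppow_le0// mul0r.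
  have tk z z' y : y < b -> truncate b (kernel rho omega z z') y =
      kernel rho omega z z' y.
    move=> yb; have [y0|y0] := ltP 0 y; first by rewrite truncate_id ?y0.
    by rewrite causal_truncate// ck.
  rewrite (eq_convl xb (tk _ _)); last exact: causal_truncate.
  by rewrite (eq_convr xb (tk _ _)).
have A1 := ae_integrable_conv iK' iK.
have A2 := ae_integrable_conv iK' (integrable_conv iK ihb).
have A3 := conv_assoc_ae iK' iK ihb.
apply: (@filterS3 _ _ (ae_filter_ringOfSetsType mu)) A1 A2 A3.
move=> t i1 i2 assoc tb.
have /andP[_ tlb] := tb.
transitivity (conv (K beta' gam') (G beta gam c h) t).
  exact: prabhakar_int_conv.
transitivity (c * conv (K beta' gam') (K beta gam) t +
    conv (K beta' gam') (conv (K beta gam) (truncate b h)) t).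
  exact: (convDr c i1 i2).
have E := etrans assoc (eq_convl tlb KK (@causal_truncate _ b h)).
exact: (f_equal2 (fun x y => c * x + y) (KK t tlb) E).
Qed.

End prabhakar_operators.

(** For [nu = 1] the inner operator is the identity by convention, so the two derivatives coincide
    and the boundary term has to vanish; this is what [hf1] provides. *)
Theorem mainTheorem3 (R : realType) (b mu nu gamma omega rho : R) (f : R -> R)
  (hb : 0 < b) (hmu : 0 < mu < 1) (hnu : 0 <= nu <= 1) (hrho : 0 < rho)
  (hf : absolutely_continuous 0 b f)
  (hf1 : nu = 1 -> lim (f x @[x --> 0^'+]) = 0) :
  \forall t \ae lebesgue_measure, 0 < t < b ->
    reg_hilfer_prabhakar rho omega gamma mu f t =
    hilfer_prabhakar rho omega gamma mu nu f t
    - t `^ (- mu) * prabhakar rho (1 - mu) (- gamma) (omega * t `^ rho)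
      * lim (f x @[x --> 0^'+]).
Proof.
have /andP[mu0 mu1] := hmu; have /andP[nu0 nu1] := hnu.
have beta0 : 0 < 1 - mu by rewrite subr_gt0.
have [nu_1|nu_neq1] := eqVneq nu 1.
  have inner : prabhakar_int rho ((1 - 1) * (1 - mu)) omega (- gamma * (1 - 1)) f = f.
    by apply/funext => x; rewrite /prabhakar_int subrr mul0r mulr0 eqxx.
  apply: aeW => t _; rewrite (hf1 nu_1) mulr0 subr0.
  by rewrite /reg_hilfer_prabhakar /hilfer_prabhakar nu_1 inner mul1r mulr1.
have nu_lt1 : 0 < 1 - nu by rewrite subr_gt0 lt_neqAle nu_neq1.
have [h ih fE] := absolutely_continuous_density hb hf.
have -> : lim (f x @[x --> 0^'+]) = f 0.
  by apply/cvg_lim => //; exact: absolutely_continuous_cvg_right hb hf.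
have f'h : {ae lebesgue_measure, forall t, 0 < t < b -> derive1 f t = h t}.
  apply: (ae_derive1_primitive (c := f 0) ih) => x /andP[x0 xb].
  by apply: fE; rewrite !ltW.
have hilfer : {ae lebesgue_measure, forall t, 0 < t < b ->
    hilfer_prabhakar rho omega gamma mu nu f t =
    f 0 * truncate b (kernel rho omega (1 - mu) (- gamma)) t +
    conv (truncate b (kernel rho omega (1 - mu) (- gamma))) (truncate b h) t}.
  have beta1 : 0 < (1 - nu) * (1 - mu) by rewrite mulr_gt0.
  have D1 := ae_derive1_prabhakar_int omega hrho hb
    (- gamma * (1 - nu)) beta1 ih fE.
  (* For [nu = 0] the outer operator is the identity by convention; its order 0 lies outside the
     range of the semigroup law. *)
  have [nu_0|nu_neq0] := eqVneq nu 0.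
    move: D1; rewrite nu_0 subr0 mul1r mulr1.
    apply: (@filterS _ _ (ae_filter_ringOfSetsType lebesgue_measure)).
    have outer (F : R -> R) x : prabhakar_int rho 0 omega 0 F x = F x.
      by rewrite /prabhakar_int eqxx.
    move=> t Ht /Ht; rewrite /hilfer_prabhakar.
    by rewrite mul0r mulr0 outer subr0 mul1r mulr1.
  have beta2 : 0 < nu * (1 - mu) by rewrite mulr_gt0// lt_neqAle eq_sym nu_neq0.
  have := conv_prabhakar_int hrho hb (- gamma * nu) beta1 beta2 ih D1.
  have -> : nu * (1 - mu) + (1 - nu) * (1 - mu) = 1 - mu by ring.
  by have -> : - gamma * nu + - gamma * (1 - nu) = - gamma by ring.
apply: (@filterS _ _ (ae_filter_ringOfSetsType lebesgue_measure)) hilfer.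
move=> t Ht tb; rewrite (Ht tb) truncate_id//.
have /andP[t0 _] := tb.
have -> : reg_hilfer_prabhakar rho omega gamma mu f t =
    conv (truncate b (kernel rho omega (1 - mu) (- gamma))) (truncate b h) t.
  apply: prabhakar_int_conv => //; first exact: causal_truncate.
  apply: (@filterS _ _ (ae_filter_ringOfSetsType lebesgue_measure)) f'h.
  by move=> y Hy yb; rewrite truncate_id// Hy.
rewrite /kernel ppow_gt0E// (_ : 1 - mu - 1 = - mu); last by ring.
by rewrite [_ * f 0]mulrC [f 0 * _]mulrC; ring.
Qed.
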